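(* Let $P$ be a maximal ranked poset. Then the number of triangular $2$-faces of the order polytope $\mathcal O(P)$ equals the number of triangular $2$-faces of the chain polytope $\mathcal C(P)$ if and only if $P$ does not contain an $X$-poset as a subposet.
   Context: For a finite poset $P=\{p_1,\dots,p_d\}$, the order polytope is $\mathcal O(P)=\{x\in\mathbb R^d: 0\le x_i\le 1 \text{ for all } i,\ x_i\ge x_j \text{ if } p_i\le p_j \text{ in } P\}$ and the chain polytope is $\mathcal C(P)=\{x\in\mathbb R^d: x_i\ge 0 \text{ for all } i,\ x_{i_1}+\dots+x_{i_k}\le 1 \text{ if } p_{i_1}<\dots<p_{i_k} \text{ in } P\}$. A triangular 2-face is a 2-dimensional face with exactly three vertices. The length of a chain $C$ is $|C|-1$; $P$ is graded of rank $n$ if every maximal chain has length $n$, and then $P=\bigcup_{i=0}^n P_i$ where every maximal chain is $p_0<\dots<p_n$ with $p_i\in P_i$. $P$ is a maximal ranked poset if it is graded and any two elements of distinct ranks are comparable. $P$ contains an $X$-poset as a subposet if there are five pairwise distinct elements $a,b,c,d,e\in P$ such that $a$ and $b$ are incomparable, $d$ and $e$ are incomparable, and $a<c<d$, $b<c<e$ (the five-element poset with two minimal elements below $c$ and two maximal elements above $c$). *)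

(* Defs.v *)
From HB Require Import structures.
From mathcomp Require Import all_boot all_order all_algebra.
From mathcomp Require Import reals.
Set Implicit Arguments. Unset Strict Implicit. Unset Printing Implicit Defensive.
Import Order.TTheory GRing.Theory Num.Theory.

Section Posets.
Variables (disp : Order.disp_t) (T : finPOrderType disp).

Definition is_chain (C : {set T}) : bool :=
  [forall x in C, forall y in C, (x >=< y)%O].

Definition is_max_chain (C : {set T}) : bool :=
  is_chain C && [forall D : {set T}, (is_chain D && (C \subset D)) ==> (D == C)].

Definition graded_of_rank (n : nat) : Prop :=
  forall C : {set T}, is_max_chain C -> #|C| = n.+1.

Definition graded : Prop := exists n, graded_of_rank n.

(* rank of x : length of a longest chain whose top element is x;
   in a graded poset, x lies in P_i iff rank x = i. *)
Definition rank (x : T) : nat :=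
  \max_(C : {set T} | is_chain C && (x \in C) && [forall y in C, (y <= x)%O])
     #|C|.-1.

Definition maximal_ranked : Prop :=
  graded /\ forall x y : T, rank x <> rank y -> (x >=< y)%O.

Definition contains_X : Prop :=
  exists a b c d e : T,
    uniq [:: a; b; c; d; e] /\
    (a >< b)%O /\ (d >< e)%O /\
    (a < c)%O /\ (c < d)%O /\ (b < c)%O /\ (c < e)%O.

End Posets.

Local Open Scope ring_scope.

Section Polytopes.
Variables (R : realType) (X : finType).

Definition pt := X -> R.

Definition dotp (c x : pt) : R := \sum_(i : X) c i * x i.

(* F is a face of K: K intersected with a supporting hyperplane
   (c = 0, b = 0 gives K itself; the empty set is also a face). *)
Definition face (K F : pt -> Prop) : Prop :=
  exists (c : pt) (b : R),
    (forall x, K x -> dotp c x <= b) /\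
    (forall x, F x <-> (K x /\ dotp c x = b)).

Definition vertex (K : pt -> Prop) (v : pt) : Prop :=
  face K (fun x => x = v).

Definition aff_indep (k : nat) (p : 'I_k.+1 -> pt) : Prop :=
  forall lam : 'I_k.+1 -> R,
    \sum_i lam i = 0 -> (forall t : X, \sum_i lam i * p i t = 0) ->
    forall i, lam i = 0.

Definition dim_ge (F : pt -> Prop) (k : nat) : Prop :=
  exists p : 'I_k.+1 -> pt, (forall i, F (p i)) /\ aff_indep p.

Definition dim_eq (F : pt -> Prop) (k : nat) : Prop :=
  dim_ge F k /\ ~ dim_ge F k.+1.

(* triangular 2-face of K: a 2-dimensional face with exactly three vertices
   (its vertices being the vertices of K lying in F) *)
Definition tri_2face (K F : pt -> Prop) : Prop :=
  face K F /\ dim_eq F 2 /\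
  exists v1 v2 v3 : pt,
    [/\ v1 <> v2, v1 <> v3, v2 <> v3 &
        forall v, (vertex K v /\ F v) <-> (v = v1 \/ v = v2 \/ v = v3)].

Definition num_tri_2faces (K : pt -> Prop) (n : nat) : Prop :=
  exists f : 'I_n -> (pt -> Prop),
    injective f /\
    (forall i, tri_2face K (f i)) /\
    (forall F, tri_2face K F -> exists i, f i = F).

End Polytopes.

Section OrderChain.
Variables (R : realType) (disp : Order.disp_t) (T : finPOrderType disp).

Definition order_polytope : pt R T -> Prop := fun x =>
  (forall i, 0 <= x i <= 1) /\ (forall i j : T, (i <= j)%O -> x j <= x i).

Definition chain_polytope : pt R T -> Prop := fun x =>
  (forall i, 0 <= x i) /\
  (forall C : {set T}, is_chain C -> \sum_(i in C) x i <= 1).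

End OrderChain.

Arguments order_polytope R {disp} T _.
Arguments chain_polytope R {disp} T _.
Arguments maximal_ranked {disp} T.
Arguments contains_X {disp} T.

(* Main.v *)
Require Import Defs.
From HB Require Import structures.
From mathcomp Require Import all_boot all_order all_algebra.
From mathcomp Require Import reals.
From mathcomp Require Import boolp zify lra.
Set Implicit Arguments. Unset Strict Implicit. Unset Printing Implicit Defensive.
Import Order.TTheory GRing.Theory Num.Theory.

(** Both polytopes are convex hulls of 0/1 vectors, the indicators of the
    down-sets, resp. of the antichains, so a triangular 2-face is the same thing
    as a set of three vertices that is exactly the set of maximizers of a linear
    form. For [O(P)] these are the chains [I < J < K] of down-sets all of whose
    differences are connected. When incomparability is an equivalence relation,
    every antichain lies in one rank; encoding a down-set by its maximal elements
    turns both families of triangles into transitive triples of antichains for two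
    relations that almost coincide: [A -> B] if [B] is [A] (nonempty) plus one
    element, or if [A] lies below [B], except that one particular [p B] below [B]
    is joined to [B] only when [#|B| = 1]. Here [p B] is empty for [C(P)] and is
    the set of maximal elements strictly below [B] for [O(P)]. The in-degrees do
    not depend on [p], and counting the triples with top [B] shows that [C(P)] has
    one more triangle for each pair of antichains [A], [B] with at least two
    elements and some [c] with [A < c < B], that is, for each X-poset pattern. *)

(** * Faces of 0/1 polytopes *)

Lemma cards3P (T : finType) (G : {set T}) : #|G| = 3 -> exists A B C,
  [/\ A != B, A != C, B != C & G = [set A; B; C]].
Proof.
move=> G3; have [A AG] : exists A, A \in G by apply/card_gt0P; rewrite G3.
have /eqP/cards2P[B [C [BC E]]] : #|G :\ A| = 2 by move: (cardsD1 A G); rewrite AG G3 => -[].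
have := setD11 A G; rewrite E !inE => /norP[AB AC].
exists A, B, C; split=> //; by rewrite -(setD1K AG) E setUA.
Qed.

Section ZeroOnePolytopes.
Local Open Scope ring_scope.
Variables (R : realType) (X : finType).
Implicit Types (K : pt R X -> Prop) (A B C : {set X}) (F G : {set {set X}}).

Definition ind A : pt R X := fun i => (i \in A)%:R.

Lemma ind_inj : injective ind.
Proof.
move=> A B eqAB; apply/setP => i.
have := congr1 (fun f => f i) eqAB; rewrite /ind.
by case: (i \in A); case: (i \in B) => //= /eqP; rewrite ?oner_eq0 // eq_sym oner_eq0.
Qed.

Lemma dotp_ind (c : pt R X) A : dotp c (ind A) = \sum_(i in A) c i.
Proof.
rewrite /dotp /ind [RHS]big_mkcond /=; apply: eq_bigr => i _.
by case: (i \in A); rewrite ?mulr1 ?mulr0.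
Qed.

(** Weights live on all sets and vanish outside [F], so sums for different families share one index
    type. *)
Definition conv F (x : pt R X) : Prop :=
  exists lam : {set X} -> R,
    [/\ forall A, 0 <= lam A, forall A, A \notin F -> lam A = 0,
        \sum_A lam A = 1 & forall i, x i = \sum_A lam A * ind A i].

(** The bound [b] need not be attained: a condition met by no member of [F] may be exposed, which
    lets conditions be intersected freely. *)
Definition exposed F (P : {set X} -> Prop) : Prop :=
  exists c : pt R X, exists b : R,
    forall A, A \in F -> dotp c (ind A) <= b /\ (dotp c (ind A) = b <-> P A).

(* The vertex sets of the faces that have exactly three vertices. *)
Definition exposed3 F : {set {set {set X}}} :=
  [set G : {set {set X}} | (G \subset F) && (#|G| == 3%N) && `[< exposed F (fun A => A \in G) >]].

Lemma conv_ind F A : A \in F -> conv F (ind A).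
Proof.
move=> AF; exists (fun B => (B == A)%:R); split=> [B|B BF||i].
- by rewrite ler0n.
- by case: eqP BF => // ->; rewrite AF.
- by rewrite (bigD1 A) //= eqxx big1 ?addr0 // => B /negbTE ->.
- rewrite (bigD1 A) //= eqxx mul1r big1 ?addr0 // => B /negbTE ->.
  by rewrite mul0r.
Qed.

Lemma conv_dotp (c x : pt R X) (lam : {set X} -> R) :
  (forall i, x i = \sum_A lam A * ind A i) ->
  dotp c x = \sum_A lam A * dotp c (ind A).
Proof.
move=> xE; rewrite /dotp.
under eq_bigr do rewrite xE mulr_sumr.
rewrite exchange_big /=; apply: eq_bigr => A _; rewrite mulr_sumr.
by apply: eq_bigr => i _; rewrite mulrCA.
Qed.

Lemma conv_ge0_le1 F x i : conv F x -> 0 <= x i <= 1.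
Proof.
case=> lam [lam0 _ lam1 ->]; apply/andP; split.
  by apply: sumr_ge0 => A _; rewrite mulr_ge0 ?ler0n.
rewrite -lam1; apply: ler_sum => A _; rewrite /ind.
by case: (i \in A); rewrite ?mulr1 ?mulr0.
Qed.

(** A weighted mean of numbers at most [b] equals [b] only if every number below [b] has weight
    zero; this is the equality case of [leif_sum]. *)
Lemma face_hull (c : pt R X) (b : R) F x :
  (forall A, A \in F -> dotp c (ind A) <= b) -> conv F x ->
  dotp c x <= b /\
  (dotp c x = b <-> conv [set A in F | dotp c (ind A) == b] x).
Proof.
move=> leb [lam [lam0 lamF lam1 xE]].
have bE : b = \sum_A lam A * b by rewrite -mulr_suml lam1 mul1r.
have le A : true ->
    lam A * dotp c (ind A) <= lam A * b ?= iff (lam A == 0) || (dotp c (ind A) == b).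
  move=> _; apply/leifP; case: ifPn => [/orP[/eqP->|/eqP->]|] //.
    by rewrite !mul0r.
  rewrite negb_or => /andP[lamA cA].
  have AF : A \in F by apply: contraNT lamA => /lamF->.
  rewrite ltr_pM2l ?lt_neqAle ?cA ?leb //.
  by rewrite eq_sym lamA lam0.
have := leif_sum le; rewrite -bE -(conv_dotp _ xE) => -[le1 le2].
split=> //; split=> [/eqP|[mu [_ muG mu1 xmu]]].
  rewrite le2 => /forallP /= H; exists lam; split=> // A; rewrite inE.
  by have := H A; case: eqP => //= _ /eqP->; rewrite eqxx andbT => /lamF.
rewrite (conv_dotp _ xmu) -[RHS]mul1r -mu1 mulr_suml; apply: eq_bigr => A _.
have [|/muG->] := boolP (A \in [set A in F | dotp c (ind A) == b]).
  by rewrite inE => /andP[_ /eqP->].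
by rewrite !mul0r.
Qed.

Lemma conv_neq0 G x : conv G x -> exists A, A \in G.
Proof.
case=> lam [_ lamG lam1 _]; have [G0|[A AG]] := set_0Vmem G; last by exists A.
move: lam1; rewrite big1 => [/eqP|A _]; first by rewrite eq_sym oner_eq0.
by apply: lamG; rewrite G0 inE.
Qed.

(** At a coordinate separating two of the points, the third agrees with one of them, and the
    zero-sum condition kills the coefficient of the other. So each pair contains a zero coefficient;
    at most one is left, and it equals the sum. *)
Lemma aff_indep_ind (p : 'I_3 -> {set X}) :
  injective p -> aff_indep (fun i => ind (p i)).
Proof.
move=> pinj lam; rewrite !big_ord_recl big_ord0.
set i0 := ord0; set i1 := lift _ _; set i2 := lift _ _ => lam0 /= lamp.
have sep i j : i != j -> exists t, (t \in p i) != (t \in p j).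
  move=> ij; apply/existsP; rewrite -negb_forall; apply: contraNN ij => /forallP H.
  by apply/eqP/pinj/setP => t; apply/eqP.
have [t01 d01] := sep i0 i1 isT; have [t02 d02] := sep i0 i2 isT.
have [t12 d12] := sep i1 i2 isT.
have zero (a b c : bool) (x y z : R) : a != b -> x + y + z = 0 ->
    x * a%:R + y * b%:R + z * c%:R = 0 -> x = 0 \/ y = 0.
  by case: a; case: b; case: c => //= _ e e'; first [left; lra | right; lra].
have s0 : lam i0 + lam i1 + lam i2 = 0 by rewrite -lam0 !addrA addr0.
have s t : lam i0 * (t \in p i0)%:R + lam i1 * (t \in p i1)%:R
    + lam i2 * (t \in p i2)%:R = 0.
  by rewrite -[RHS](lamp t) !big_ord_recl big_ord0 !addrA addr0.
have {sep zero}: [/\ lam i0 = 0, lam i1 = 0 & lam i2 = 0].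
  have z01 := zero _ _ _ _ _ _ d01 s0 (s t01).
  have z02 : lam i0 = 0 \/ lam i2 = 0.
    by apply: (zero _ _ _ _ _ _ d02 _ _); rewrite addrAC; [exact: s0|exact: s].
  have z12 : lam i1 = 0 \/ lam i2 = 0.
    by apply: (zero _ _ _ _ _ _ d12 _ _); rewrite addrC addrA; [exact: s0|exact: s].
  clear -s0 z01 z02 z12.
  by case: z01 => z; case: z02 => z'; case: z12 => z''; split; lra.
case=> l0 l1 l2 i.
case: i => -[|[|[|//]]] Hi.
- by rewrite -l0; congr lam; apply: val_inj.
- by rewrite -l1; congr lam; apply: val_inj.
- by rewrite -l2; congr lam; apply: val_inj.
Qed.

(** The weights of [k.+1] points over at most [k] generators form a matrix with a nonzero left
    kernel vector, which is an affine dependence of the points. *)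
Lemma conv_dim_lt G k (P : pt R X -> Prop) :
  (forall x, P x -> conv G x) -> (#|G| <= k)%N -> ~ dim_ge P k.
Proof.
move=> PG Gk [p [Pp]].
have /choice[mu muP] := fun i => PG _ (Pp i).
pose M : 'M[R]_(k.+1, #|G|) := \matrix_(i, j) mu i (enum_val j).
have muM (f : {set X} -> R) i : \sum_A mu i A * f A = \sum_j M i j * f (enum_val j).
  have [_ muG _ _] := muP i.
  rewrite (bigID (mem G)) /= [X in _ + X]big1 ?addr0 => [|A /muG->]; last by rewrite mul0r.
  rewrite big_enum_val /=; apply: eq_bigr => j _; by rewrite mxE.
have : kermx M != 0.
  by rewrite kermx_eq0 -row_leq_rank -ltnNge ltnS (leq_trans (rank_leq_col _)).
case/rowV0Pn => v /sub_kermxP vM v0 aff.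
have vM0 j : \sum_i v 0 i * M i j = 0.
  by have := congr1 (fun N : 'rV_ _ => N 0 j) vM; rewrite !mxE.
(* Used with [f] constant for the zero-sum condition and with [f] a coordinate for the dependence
   itself. *)
have key (f : {set X} -> R) (g : 'I_k.+1 -> R) :
    (forall i, g i = \sum_A mu i A * f A) -> \sum_i v 0 i * g i = 0.
  move=> gE; under eq_bigr do rewrite gE muM mulr_sumr.
  rewrite exchange_big /= big1 // => j _.
  under eq_bigr do rewrite mulrA.
  by rewrite -mulr_suml vM0 mul0r.
move/negP: v0; apply; apply/eqP/rowP => i; rewrite mxE.
apply: (aff (fun i => v 0 i)) => [|t].
  rewrite -[RHS](key (fun _ => 1) (fun _ => 1)) => [|j].
    by apply: eq_bigr => j _ /=; rewrite mulr1.
  by under eq_bigr do rewrite mulr1; have [_ _ -> _] := muP j.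
by apply: (key (fun A => ind A t)) => j; have [_ _ _ ->] := muP j.
Qed.

Section Faces.
Variables (K : pt R X -> Prop) (F : {set {set X}}).
Hypothesis indK : forall A, A \in F -> K (ind A).
Hypothesis Kconv : forall x, K x -> conv F x.

Lemma vertexP v : vertex K v <-> exists2 A, A \in F & v = ind A.
Proof.
split=> [[c [b [leb vP]]]|[A AF ->]].
  have [Kv cv] := (vP v).1 erefl.
  have leF A : A \in F -> dotp c (ind A) <= b by move=> AF; apply/leb/indK.
  have /conv_neq0[A] := (face_hull leF (Kconv Kv)).2.1 cv.
  rewrite inE => /andP[AF /eqP cA]; exists A => //.
  by apply/esym/vP; split => //; apply: indK.
(* Over the whole cube this form is maximal only at [ind A]. *)
exists (fun i => if i \in A then 1 else -1), (\sum_i ind A i).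
have le x : K x -> dotp (fun i => if i \in A then 1 else -1) x <=
    \sum_i ind A i ?= iff [forall i, x i == ind A i].
  move=> /Kconv Kx; apply: leif_sum => i _; rewrite /ind.
  have /andP[x0 x1] := conv_ge0_le1 i Kx; clear -x0 x1.
  case: (i \in A); apply/leifP; case: ifPn => [/eqP->|ne]; rewrite ?mulr1 ?mulr0 //.
    by rewrite mul1r lt_neqAle ne.
  by rewrite mulN1r oppr_lt0 lt_neqAle eq_sym ne.
split=> [x Kx|x]; first by case: (le x Kx).
split=> [->|[Kx]].
  have KA := indK AF; split=> //; apply/eqP; rewrite (le _ KA).2.
  by apply/forallP => i; rewrite eqxx.
by move/eqP; rewrite (le x Kx).2 => /forallP H; apply/funext => i; apply/eqP.
Qed.

(** Convexity of [K] is not among the hypotheses; the first conjunct places the hull inside [K], as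
    a face must be. *)
Definition hull G (x : pt R X) : Prop := K x /\ conv G x.

(** The form exposing the vertex [ind A] attains its maximum over the hull of [G] at a member of
    [G], which can only be [A]. *)
Lemma hull_ind G A : A \in F -> G \subset F -> hull G (ind A) -> A \in G.
Proof.
move=> AF GF [_ AG].
have /vertexP[c [b [leb vP]]] : exists2 B, B \in F & ind A = ind B by exists A.
have [KA cA] := (vP _).1 erefl.
have leG B : B \in G -> dotp c (ind B) <= b.
  by move=> BG; apply/leb/indK/(subsetP GF).
have /conv_neq0[B] := (face_hull leG AG).2.1 cA.
rewrite inE => /andP[BG /eqP cB].
suff /ind_inj <- : ind B = ind A by [].
by apply/vP; split=> //; apply/indK/(subsetP GF).
Qed.

Lemma exposed3_face G : G \in exposed3 F -> face K (hull G).
Proof.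
rewrite !inE => /andP[/andP[GF _]] /asboolP[c [b cb]].
have leF A : A \in F -> dotp c (ind A) <= b by move=> /cb[].
have GE : [set A in F | dotp c (ind A) == b] = G.
  apply/setP => A; rewrite inE; apply/andP/idP => [[/cb[_ cA] /eqP/cA] //|AG].
  by have AF := subsetP GF _ AG; split=> //; apply/eqP/(cb _ AF).2.
exists c, b; rewrite -GE; split=> x; last split.
- by move=> /Kconv /(face_hull leF)[].
- by case=> Kx Gx; split=> //; apply: (face_hull leF (Kconv Kx)).2.2.
- by case=> Kx cx; split=> //; apply: (face_hull leF (Kconv Kx)).2.1.
Qed.

(** The dimension is two because three distinct 0/1 vectors are affinely independent, while the hull
    of three points contains no four such points. *)
Lemma exposed3_tri_2face G : G \in exposed3 F -> tri_2face K (hull G).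
Proof.
move=> Gexp; split; first exact: exposed3_face.
move: Gexp; rewrite !inE => /andP[/andP[GF /eqP cardG] _].
have hullG A : A \in G -> hull G (ind A).
  by move=> AG; split; [apply/indK/(subsetP GF)|apply: conv_ind].
split; first split.
- exists (fun i => ind (enum_val (cast_ord (esym cardG) i))); split.
    by move=> i; apply/hullG/enum_valP.
  by apply: aff_indep_ind => i j /enum_val_inj/cast_ord_inj.
- by apply: (@conv_dim_lt G) => [x []|]; rewrite ?cardG.
have [A [B [C [AB AC BC GE]]]] := cards3P cardG.
exists (ind A), (ind B), (ind C); split.
- by move/ind_inj/eqP; rewrite (negbTE AB).
- by move/ind_inj/eqP; rewrite (negbTE AC).
- by move/ind_inj/eqP; rewrite (negbTE BC).
move=> v; split=> [[/vertexP[D DF ->]] /(hull_ind DF GF)|].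
  by rewrite GE !inE => /orP[/orP[]|] /eqP->; [left|right; left|right; right].
suff H D : D \in G -> vertex K (ind D) /\ hull G (ind D).
  by case=> [|[|]] ->; apply: H; rewrite GE !inE eqxx ?orbT.
by move=> DG; split; [apply/vertexP; exists D => //; apply: subsetP DG|apply: hullG].
Qed.

(** The form defining the face selects [G] among the indicators; by [vertexP] these are the three
    vertices, and by [face_hull] the face is their hull. *)
Lemma tri_2face_exposed3 P :
  tri_2face K P -> exists2 G, G \in exposed3 F & hull G = P.
Proof.
move=> [[c [b [leb PP]]] [_ [v1 [v2 [v3 [v12 v13 v23 vP]]]]]].
have leF A : A \in F -> dotp c (ind A) <= b by move=> AF; apply/leb/indK.
have vind v : v = v1 \/ v = v2 \/ v = v3 -> exists2 A, A \in F & v = ind A.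
  by move=> /vP[/vertexP].
have [A AF v1E] := vind v1 (or_introl erefl).
have [B BF v2E] := vind v2 (or_intror (or_introl erefl)).
have [C CF v3E] := vind v3 (or_intror (or_intror erefl)).
pose G := [set A in F | dotp c (ind A) == b].
have GE : G = [set A; B; C].
  apply/setP => D; rewrite !inE; apply/andP/idP => [[DF /eqP cD]|].
    have /vP : vertex K (ind D) /\ P (ind D).
      split; first by apply/vertexP; exists D.
      by apply/PP; split=> //; apply: indK.
    by rewrite v1E v2E v3E => -[|[|]] /ind_inj->; rewrite eqxx ?orbT.
  suff H E : E \in F -> (ind E = v1 \/ ind E = v2 \/ ind E = v3) ->
      E \in F /\ dotp c (ind E) == b.
    by case/orP => [/orP[]|] /eqP->; apply: H; rewrite ?v1E ?v2E ?v3E; tauto.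
  by move=> EF /vP[_ /PP[_ ->]].
have GF : G \subset F by apply/subsetP => D; rewrite inE => /andP[].
exists G; last first.
  apply/funext => x; apply/propext; rewrite PP; split=> -[Kx Hx]; split=> //.
    exact: (face_hull leF (Kconv Kx)).2.2.
  exact: (face_hull leF (Kconv Kx)).2.1.
rewrite !inE GF /=; apply/andP; split.
  have neq (S S' : {set X}) v w : v = ind S -> w = ind S' -> v <> w -> S != S'.
    by move=> -> ->; apply: contra_notN => /eqP->.
  rewrite GE -setUA cardsU1 cards2 !inE.
  by rewrite negb_or (neq _ _ _ _ v1E v2E) // (neq _ _ _ _ v1E v3E) // (neq _ _ _ _ v2E v3E).
apply/asboolP; exists c, b => D DF; split; first exact: leF.
by rewrite inE DF; split=> [->|/eqP//]; rewrite eqxx.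
Qed.

Lemma hull_inj : {in exposed3 F &, injective hull}.
Proof.
move=> G H; rewrite !inE => /andP[/andP[GF _] _] /andP[/andP[HF _] _].
suff sub (G1 G2 : {set {set X}}) : G1 \subset F -> G2 \subset F ->
    hull G1 = hull G2 -> G1 \subset G2.
  by move=> E; apply/eqP; rewrite eqEsubset; apply/andP; split; apply: sub.
move=> G1F G2F E; apply/subsetP => A AG; have AF := subsetP G1F _ AG.
apply: hull_ind => //; rewrite -E; split; first exact: indK.
exact: conv_ind.
Qed.

Lemma num_tri_2facesP n : num_tri_2faces K n <-> n = #|exposed3 F|.
Proof.
have num : num_tri_2faces K #|exposed3 F|.
  exists (fun i => hull (enum_val i)); split; last split.
  - move=> i j /hull_inj E; apply: enum_val_inj; apply: E; exact: enum_valP.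
  - by move=> i; apply/exposed3_tri_2face/enum_valP.
  - move=> P /tri_2face_exposed3[G GF <-]; exists (enum_rank_in GF G).
    by rewrite enum_rankK_in.
have le m k : num_tri_2faces K m -> num_tri_2faces K k -> (m <= k)%N.
  move=> [f [finj [ftri _]]] [g [_ [_ gsurj]]].
  have /choice[h hP] := fun i => gsurj _ (ftri i).
  have hinj : injective h by move=> i j E; apply: finj; rewrite -!hP E.
  by have := leq_card h hinj; rewrite !card_ord.
by split=> [numn|->//]; apply/eqP; rewrite eqn_leq !le.
Qed.

End Faces.
End ZeroOnePolytopes.

(** * Linear forms that cut out conditions on sets *)

Section Exposure.
Local Open Scope ring_scope.
Variables (R : realType) (X : finType).
Implicit Types (A B S : {set X}) (F G : {set {set X}}) (P Q : {set X} -> Prop).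

Local Notation exposed := (@exposed R X).
Local Notation exposed3 := (@exposed3 R X).

Lemma exposed_ext F P Q :
  (forall A, A \in F -> P A <-> Q A) -> exposed F P -> exposed F Q.
Proof.
move=> PQ [c [b H]]; exists c, b => A AF; have [le iffP] := H A AF.
by split=> //; rewrite iffP; apply: PQ.
Qed.

Lemma exposedT F : exposed F (fun=> True).
Proof.
exists (fun=> 0), 0 => A _; rewrite dotp_ind big1 //.
Qed.

(** Add the two forms: the sum reaches [b + b'] only where both reach their bounds. *)
Lemma exposedI F P Q : exposed F P -> exposed F Q -> exposed F (fun A => P A /\ Q A).
Proof.
move=> [c [b H]] [c' [b' H']]; exists (fun i => c i + c' i), (b + b') => A AF.
have -> : dotp (fun i => c i + c' i) (ind R A) = dotp c (ind R A) + dotp c' (ind R A).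
  by rewrite /dotp -big_split /=; apply: eq_bigr => i _; rewrite mulrDl.
have [le <-] := H A AF; have [le' <-] := H' A AF; clear -le le'.
by split; [lra|split=> [?|[? ?]]; [split|]; lra].
Qed.

Lemma exposed_imp F (b : bool) P :
  (b -> exposed F P) -> exposed F (fun A => b -> P A).
Proof.
case: b => [/(_ isT)|_]; first by apply: exposed_ext => A _; split=> [//|/(_ isT)].
by apply: exposed_ext (exposedT F).
Qed.

Lemma exposed_forall F (I : finType) (P : I -> {set X} -> Prop) :
  (forall k, exposed F (P k)) -> exposed F (fun A => forall k, P k A).
Proof.
move=> expP; suff H (s : seq I) : exposed F (fun A => forall k, k \in s -> P k A).
  apply: exposed_ext (H (enum I)) => A _; split=> H' k; last by [].
  by apply: H'; rewrite mem_enum.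
elim: s => [|i s IHs]; first by apply: exposed_ext (exposedT F).
apply: exposed_ext (exposedI (expP i) IHs) => A _; split=> [[Pi Ps] k|H].
  by rewrite inE => /orP[/eqP->|/Ps].
by split=> [|k ks]; apply: H; rewrite inE ?eqxx ?ks ?orbT.
Qed.

Lemma dotp_delta i A (a : R) :
  dotp (fun j => if j == i then a else 0) (ind R A) = a * (i \in A)%:R.
Proof.
rewrite /dotp (bigD1 i) //= eqxx big1 ?addr0 // => j /negbTE->.
by rewrite mul0r.
Qed.

Lemma exposed_notin F i : exposed F (fun A => i \notin A).
Proof.
exists (fun j => if j == i then -1 else 0), 0 => A _; rewrite dotp_delta.
case: (i \in A) => /=; first by split; [|split=> //]; lra.
by rewrite mulr0.
Qed.

Lemma exposed_in F i : exposed F (fun A => i \in A).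
Proof.
exists (fun j => if j == i then 1 else 0), 1 => A _; rewrite dotp_delta mul1r.
by case: (i \in A) => //=; split; [|split=> //]; lra.
Qed.

(** This is the face where the inequality [x j <= x i], valid on [F], becomes an equality. *)
Lemma exposed_in_imp F i j : (forall A, A \in F -> j \in A -> i \in A) ->
  exposed F (fun A => i \in A -> j \in A).
Proof.
move=> ji; exists (fun k => (if k == j then 1 else 0) + (if k == i then -1 else 0)), 0.
move=> A AF; have -> : forall c c' : pt R X, dotp (fun k => c k + c' k) (ind R A)
    = dotp c (ind R A) + dotp c' (ind R A).
  by move=> c c'; rewrite /dotp -big_split /=; apply: eq_bigr => k _; rewrite mulrDl.
rewrite !dotp_delta; move: (ji A AF).
case: (i \in A); case: (j \in A) => //= H; try by have := H isT.
- by split; [|split=> //]; lra.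
- by split; [lra|split=> [? _|/(_ isT) //]; exfalso; lra].
- by split; [|split=> //]; lra.
Qed.

(** As a linear form, the indicator of [S] counts [A :&: S], so it reaches the bound 1 exactly on a
    nonempty intersection. *)
Lemma exposed_meet F S : (forall A, A \in F -> (#|A :&: S| <= 1)%N) ->
  exposed F (fun A => A :&: S != set0).
Proof.
move=> leS; exists (ind R S), 1 => A AF.
have -> : dotp (ind R S) (ind R A) = #|A :&: S|%:R.
  rewrite dotp_ind /ind -sumr_const [RHS]big_mkcond [LHS]big_mkcond /=.
  by apply: eq_bigr => i _; rewrite inE; case: (i \in A); case: (i \in S).
by rewrite -card_gt0; case: #|_| (leS A AF) => [|[|//]] _ //=; split; [|split=> //]; lra.
Qed.

(** The indicators of [S] and [S'] have the same sum as those of [A] and [B], so a form maximal at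
    [A] and [B] is maximal at [S] and [S']. Beyond [A] and [B] the family [G] has one member; if [S]
    were that member, so would be [S'], and [S = S'] would force [A = B]. *)
Lemma exposed3_swap F G A B S S' : G \in exposed3 F -> A \in G -> B \in G ->
  A != B -> S \in F -> S' \in F -> S :|: S' = A :|: B -> S :&: S' = A :&: B ->
  S = A \/ S = B.
Proof.
rewrite !inE => /andP[/andP[/subsetP GF /eqP G3]] /asboolP[c [b H]].
move=> AG BG AB SF S'F EU EI.
have dotU U V : dotp c (ind R U) + dotp c (ind R V) =
    dotp c (ind R (U :|: V)) + dotp c (ind R (U :&: V)).
  rewrite /dotp -!big_split /=; apply: eq_bigr => i _; rewrite -!mulrDr /ind !inE.
  by case: (i \in U); case: (i \in V); rewrite //= ?addr0 ?add0r.
have dotS : dotp c (ind R S) + dotp c (ind R S') = b + b.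
  rewrite dotU EU EI -dotU.
  by rewrite (H A (GF A AG)).2.2 // (H B (GF B BG)).2.2.
have [leS eqS] := H S SF; have [leS' eqS'] := H S' S'F.
have SG : S \in G by apply/eqS; clear -dotS leS leS'; lra.
have S'G : S' \in G by apply/eqS'; clear -dotS leS leS'; lra.
have [->|SA] := eqVneq S A; first by left.
have [->|SB] := eqVneq S B; first by right.
suff SS' : S = S'.
  move: EU EI; rewrite -SS' setUid setIid => -> /setP E.
  case/eqP: AB; apply/setP => i; have := E i; rewrite !inE.
  by case: (i \in A); case: (i \in B).
have: #|G :\ A :\ B| = 1%N.
  have := cardsD1 A G; rewrite AG G3 => -[]; rewrite (cardsD1 B (G :\ A)).
  by rewrite !inE BG eq_sym AB => -[].
move/eqP/cards1P => [C GC].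
have inC U : U \in G -> U != A -> U != B -> U = C.
  by move=> UG UA UB; apply/set1P; rewrite -GC !inE UB UA.
have S'A : S' != A.
  apply: contraNneq SB => E; apply/eqP/setP => i.
  move/setP/(_ i): EU; move/setP/(_ i): EI; rewrite E !inE.
  by case: (i \in S); case: (i \in A); case: (i \in B).
have S'B : S' != B.
  apply: contraNneq SA => E; apply/eqP/setP => i.
  move/setP/(_ i): EU; move/setP/(_ i): EI; rewrite E !inE.
  by case: (i \in S); case: (i \in A); case: (i \in B).
by rewrite (inC S) // (inC S').
Qed.

(* [Q M x] stands for membership of [x] in the [M]-fold dilate of a polytope; each
   peeling step with the largest possible [e] kills a coordinate of [x]. *)
Lemma greedy_decomposition F (Q : R -> pt R X -> Prop) : set0 \in F ->
  (forall M x, Q M x -> 0 <= M /\ forall i, 0 <= x i) ->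
  (forall M x i, Q M x -> x i != 0 -> exists A, [/\ A \in F, A != set0,
     forall j, j \in A -> x j != 0 &
     forall e : R, 0 <= e -> (forall j, j \in A -> e <= x j) ->
       Q (M - e) (fun j => x j - e * ind R A j)]) ->
  forall x, Q 1 x -> conv F x.
Proof.
move=> F0 Q0 Qpeel; pose cone M (x : pt R X) := exists lam : {set X} -> R,
  [/\ forall A, 0 <= lam A, forall A, A \notin F -> lam A = 0,
      \sum_A lam A = M & forall i, x i = \sum_A lam A * ind R A i].
suff H n M (x : pt R X) : (#|[set i | x i != 0%R]| < n)%N -> Q M x -> cone M x.
  by move=> x; apply: (H _ _ _ (ltnSn _)).
elim: n M x => // n IHn M x lt_n QMx; have [M0 x0] := Q0 _ _ QMx.
have [i xi|/(_ _)/negbFE x00] := pickP (fun i => x i != 0); last first.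
  (* When [x] vanishes, the remaining mass [M] goes to the empty set, so that the weights still sum
     to [M]. *)
  exists (fun A => if A == set0 then M else 0); split=> [A|A AF||i].
  - by case: ifP.
  - by case: eqP AF => // ->; rewrite F0.
  - by rewrite -big_mkcond /= big_pred1_eq.
  - rewrite (eqP (x00 i)) big1 // => A _; case: eqP => [->|_]; last by rewrite mul0r.
    by rewrite /ind inE mulr0.
have [A [AF /set0Pn[j0 j0A] Asupp Ae]] := Qpeel _ _ _ QMx xi.
have [j jA jmin] : exists2 j, j \in A & forall k, k \in A -> x j <= x k.
  by case: (arg_minP x j0A) => j jA jmin; exists j.
have [|lam [lam0 lamF lamM lamE]] :=
  IHn (M - x j) (fun k => x k - x j * ind R A k) _ (Ae _ (x0 j) jmin).
- rewrite -ltnS; apply: leq_trans lt_n; rewrite ltnS; apply: proper_card.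
  apply/properP; split.
    apply/subsetP => k; rewrite !inE; apply: contraNneq => xk.
    rewrite xk /ind; case: (boolP (k \in A)) => [/Asupp|_].
      by rewrite xk eqxx.
    by rewrite mulr0 subr0.
  exists j; rewrite !inE; first exact: Asupp.
  by rewrite /ind jA mulr1 subrr eqxx.
exists (fun B => lam B + if B == A then x j else 0); split=> [B|B BF||k].
- by rewrite addr_ge0 //; case: ifP.
- by rewrite lamF // add0r; case: eqP BF => // ->; rewrite AF.
- by rewrite big_split /= lamM -big_mkcond /= big_pred1_eq subrK.
- under eq_bigr do rewrite mulrDl; rewrite big_split /= -lamE.
  rewrite (bigD1 A) //= eqxx big1 ?addr0 ?subrK // => B /negbTE->.
  by rewrite mul0r.
Qed.

End Exposure.

(** * Down-sets and antichains *)

Section PosetFamilies.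
Variables (disp : Order.disp_t) (T : finPOrderType disp).
Implicit Types (A C D I J K U : {set T}) (i j k : T).

Definition antichains : {set {set T}} :=
  [set A : {set T} | [forall i in A, forall j in A, ~~ (i < j)%O]].

Definition downsets : {set {set T}} :=
  [set D : {set T} | [forall i in D, forall j, (j <= i)%O ==> (j \in D)]].

Lemma antichainP A :
  reflect (forall i j, i \in A -> j \in A -> ~~ (i < j)%O) (A \in antichains).
Proof.
rewrite inE; apply: (iffP forall_inP) => [H i j iA jA|H i iA].
  exact: (forall_inP (H i iA)).
by apply/forall_inP => j; apply: H.
Qed.

Lemma downsetP D :
  reflect (forall i j, i \in D -> (j <= i)%O -> j \in D) (D \in downsets).
Proof.
rewrite inE; apply: (iffP forall_inP) => [H i j iD ji|H i iD].
  exact: (implyP (forallP (H i iD) j)).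
by apply/forallP => j; apply/implyP; apply: H.
Qed.

Lemma chainP C : reflect (forall i j, i \in C -> j \in C -> (i >=< j)%O) (is_chain C).
Proof.
apply: (iffP forall_inP) => [H i j iC jC|H i iC]; first exact: (forall_inP (H i iC)).
by apply/forall_inP => j; apply: H.
Qed.

Lemma maximal_above (P : pred T) i : P i ->
  exists j, [/\ P j, (i <= j)%O & forall k, P k -> ~~ (j < k)%O].
Proof.
move=> Pi; have Pii : P i && (i <= i)%O by rewrite Pi lexx.
case: (@arg_maxnP _ i (fun j => P j && (i <= j)%O) (fun j => #|[set k | (k <= j)%O]|) Pii).
move=> j /andP[Pj ij] jmax.
exists j; split=> // k Pk; apply/negP => jk.
have := jmax k; rewrite Pk (le_trans ij (ltW jk)) => /(_ isT); apply/negP.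
rewrite -ltnNge; apply: proper_card; apply/properP; split.
  by apply/subsetP => l; rewrite !inE => /le_trans; apply; apply: ltW.
by exists k; rewrite !inE ?lexx // lt_geF.
Qed.

Lemma card_antichain_chain A C : A \in antichains -> is_chain C -> #|A :&: C| <= 1.
Proof.
move=> /antichainP antiA /chainP chC; apply/card_le1P => i.
rewrite inE => /andP[iA iC] j; rewrite !inE.
apply/andP/eqP => [[jA jC]|->//]; case/orP: (chC i j iC jC).
  by rewrite le_eqVlt (negbTE (antiA _ _ iA jA)) orbF => /eqP.
by rewrite le_eqVlt (negbTE (antiA _ _ jA iA)) orbF => /eqP.
Qed.

(** * Both polytopes as convex hulls of indicators *)

Section Polytopes.
Local Open Scope ring_scope.
Variable R : realType.

Lemma order_polytope_ind D : D \in downsets -> order_polytope R T (ind R D).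
Proof.
move=> /downsetP downD; split=> [i|i j ij]; rewrite /ind ?ler0n ?lern1 ?leq_b1 //.
by rewrite ler_nat; case: (boolP (j \in D)) => // /downD->.
Qed.

Lemma order_polytope_conv x : order_polytope R T x -> conv downsets x.
Proof.
move=> Px; pose Q M (x : pt R T) := [/\ 0 <= M, forall i, 0 <= x i <= M &
  forall i j, (i <= j)%O -> x j <= x i].
apply: (@greedy_decomposition _ _ _ Q) => [|M {Px}x []|M {Px}x i [M0 x01 xle] xi|].
- by apply/downsetP => i j; rewrite inE.
- by move=> M0 x01 _; split=> // i; case/andP: (x01 i).
- have xM j : 0 <= x j /\ x j <= M by apply/andP.
  have lesupp j k : (j <= k)%O -> x k != 0 -> x j != 0.
    move=> jk xk; rewrite gt_eqF // (lt_le_trans _ (xle _ _ jk)) //.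
    by rewrite lt_neqAle eq_sym xk (xM k).1.
  (* The peeled set is the support, a down-set because [x] is order-reversing. *)
  exists [set j | x j != 0]; split.
  + by apply/downsetP => k j; rewrite !inE => xk jk; apply: lesupp xk.
  + by apply/set0Pn; exists i; rewrite inE.
  + by move=> j; rewrite inE.
  + move=> e e0 ex; have ei : e <= x i by apply: ex; rewrite inE.
    split=> [|j|j k jk]; rewrite /ind ?inE.
    * by rewrite subr_ge0 (le_trans ei) ?(xM i).2.
    * case: eqVneq => [->|xj] /=; rewrite ?mulr0 ?subr0 ?lexx ?subr_ge0 ?mulr1.
        by rewrite (le_trans ei) ?(xM i).2.
      by rewrite ex ?inE // lerB ?(xM j).2.
    * have := lesupp j k jk; have := xle j k jk; have := ex j; rewrite inE.
      case: (eqVneq (x k) 0) => [->|xk] /=; last first.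
        by move=> _ ? /(_ isT)->; rewrite lerB.
      case: eqVneq => [->|xj] /=; rewrite ?mulr0 ?mulr1 ?subr0 //.
      by rewrite subr_ge0 => /(_ isT).
- by case: Px => x01 xle; split=> //; apply: ler01.
Qed.

Lemma chain_polytope_ind A : A \in antichains -> chain_polytope R T (ind R A).
Proof.
move=> antiA; split=> [i|C chC]; first by rewrite ler0n.
rewrite [leLHS](_ : _ = #|A :&: C|%:R) ?lern1 ?card_antichain_chain //.
rewrite /ind -sumr_const [RHS]big_mkcond [LHS]big_mkcond /=.
by apply: eq_bigr => i _; rewrite inE; case: (i \in A); case: (i \in C).
Qed.

Lemma chain_polytope_conv x : chain_polytope R T x -> conv antichains x.
Proof.
move=> Px; pose Q M (x : pt R T) := (forall i, 0 <= x i) /\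
  forall C, is_chain C -> \sum_(i in C) x i <= M.
apply: (@greedy_decomposition _ _ _ Q) => [|M {Px}x []|M {Px}x i [x0 xle] xi|//].
- by apply/antichainP => i j; rewrite inE.
- move=> x0 /(_ set0); rewrite big_set0 => H; split=> //; apply: H.
  by apply/chainP => j k; rewrite inE.
pose A := [set j | (x j != 0) && [forall (k | x k != 0), ~~ (j < k)%O]].
have Aabove j : x j != 0 -> exists2 k, k \in A & (j <= k)%O.
  move=> xj; have [k [xk jk kmax]] := @maximal_above (fun k => x k != 0) j xj.
  by exists k => //; rewrite inE xk; apply/forall_inP.
have [a0 a0A _] := Aabove i xi.
exists A; split.
- apply/antichainP => j k; rewrite !inE => /andP[_ /forall_inP jmax] /andP[xk _].
  exact: jmax.
- by apply/set0Pn; exists a0.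
- by move=> j; rewrite inE => /andP[].
move=> e e0 ex; split=> [j|C chC].
  rewrite /ind; case: (boolP (j \in A)) => [/ex|_]; first by rewrite mulr1 subr_ge0.
  by rewrite mulr0 subr0.
rewrite sumrB -mulr_sumr.
have [AC0|[a]] := set_0Vmem (A :&: C); last first.
  rewrite inE => /andP[aA aC]; apply: lerB; first exact: xle.
  rewrite -[leLHS]mulr1 ler_wpM2l // (bigD1 a) //= /ind aA.
  by rewrite lerDl sumr_ge0 // => j _; rewrite ler0n.
rewrite [X in _ - _ * X]big1 => [|j jC]; last first.
  have /setP/(_ j) := AC0; rewrite !inE jC andbT /ind.
  by rewrite inE => ->.
rewrite mulr0 subr0.
pose C' := [set j in C | x j != 0].
have sumC' : \sum_(j in C) x j = \sum_(j in C') x j.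
  rewrite (bigID (fun j => x j != 0)) /= [X in _ + X]big1 ?addr0.
    by apply: eq_bigl => j; rewrite inE.
  by move=> j /andP[_ /negPn/eqP].
(* the top of a chain missing [A] lies below some element of [A], which extends it *)
have [a aA aC'] : exists2 a, a \in A & forall j, j \in C' -> (j <= a)%O.
  have [C'0|[c cC']] := set_0Vmem C'.
    by exists a0 => // j; rewrite C'0 inE.
  have [t [tC' _ tmax]] := @maximal_above (mem C') c cC'.
  have [tC xt] : t \in C /\ x t != 0 by apply/andP; move: tC'; rewrite /= inE.
  have [a aA ta] := Aabove t xt; exists a => // j jC'.
  apply: le_trans ta; have jC : j \in C by move: jC'; rewrite inE => /andP[].
  case/orP: ((chainP _ chC) j t jC tC) => //; rewrite le_eqVlt => /orP[/eqP->//|].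
  by rewrite (negbTE (tmax j jC')).
have aC : a \notin C'.
  by have /setP/(_ a) := AC0; rewrite in_set in_set0 aA [a \in C']inE => /= ->.
have : \sum_(j in a |: C') x j <= M.
  apply: xle; apply/chainP => j k; rewrite !in_setU1.
  move=> /predU1P[->|jC'] /predU1P[->|kC'].
  - exact: comparablexx.
  - by rewrite /Order.comparable aC' ?orbT.
  - by rewrite /Order.comparable aC'.
  - by apply: (chainP _ chC); move: jC' kC'; rewrite !inE => /andP[+ _] /andP[].
rewrite big_setU1 //= -sumC' => le.
by rewrite lerBrDr addrC (le_trans _ le) // lerD2r ex.
Qed.

End Polytopes.
End PosetFamilies.

(** * Triangular faces of the order polytope *)

Section OrderPolytopeTriangles.
Variables (R : realType) (disp : Order.disp_t) (T : finPOrderType disp).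
Implicit Types (A D I J K S U : {set T}) (i j k : T).

(** Connectedness in the comparability graph: no nonempty proper part is a union of components. *)
Definition connected S : Prop :=
  S != set0 /\ forall U, U \subset S -> U != set0 ->
    (forall u v, u \in U -> v \in S -> (u >=< v)%O -> v \in U) -> U = S.

(** The known description of the edges of the order polytope, directed from the smaller down-set to
    the larger. *)
Definition linked I J : Prop := I \subset J /\ connected (J :\: I).

Lemma linked_neq I J : linked I J -> I != J.
Proof. by case=> _ [+ _]; apply: contraNneq => ->; rewrite setDv. Qed.

(** Closed downwards and, inside [S], upwards, [D] meets [S] in a union of components. *)
Lemma connected_block S D : connected S -> D \in downsets T ->
  (forall i j, i \in S -> j \in S -> (i <= j)%O -> i \in D -> j \in D) ->
  (forall i, i \in S -> i \notin D) \/ S \subset D.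
Proof.
move=> [_ conS] /downsetP downD upD.
have [SD0|neq0] := eqVneq (S :&: D) set0.
  by left=> i iS; apply/negP => iD; have := in_set0 i; rewrite -SD0 inE iS iD.
right; apply/setIidPl/conS => [|//|u v]; first exact: subsetIl.
rewrite !inE => /andP[uS uD] vS; rewrite vS => /orP[uv|vu].
  exact: upD uD.
exact: downD vu.
Qed.

(** The face asks that [D] contain [I], lie in [K], and be up-closed inside each of the blocks
    [J :\: I] and [K :\: J]. By connectedness [D] contains or misses each block; three of the four
    choices give [I], [J] and [K]. *)
Lemma exposed3_linked I J K :
  I \in downsets T -> J \in downsets T -> K \in downsets T ->
  linked I J -> linked J K -> linked I K -> [set I; J; K] \in exposed3 R (downsets T).
Proof.
move=> dI dJ dK lIJ lJK lIK.
rewrite inE; apply/andP; split; first (apply/andP; split).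
- by apply/subsetP => D; rewrite !in_setU !in_set1 => /orP[/orP[]|] /eqP->.
- rewrite -setUA cardsU1 cards2 !inE negb_or !linked_neq //.
apply/asboolP.
have [IJ cIJ] := lIJ; have [JK cJK] := lJK; have [IK cIK] := lIK.
pose up S D := forall i j, [&& i \in S, j \in S & (i <= j)%O] -> i \in D -> j \in D.
have exp_up S : exposed R (downsets T) (up S).
  apply: exposed_forall => i; apply: exposed_forall => j.
  apply: exposed_imp => /and3P[_ _ ij]; apply: exposed_in_imp => D /downsetP dD jD.
  exact: dD ij.
have exp_in : exposed R (downsets T) (fun D => forall i, i \in I -> i \in D).
  by apply: exposed_forall => i; apply: exposed_imp => _; apply: exposed_in.
have exp_notin : exposed R (downsets T) (fun D => forall i, i \notin K -> i \notin D).
  by apply: exposed_forall => i; apply: exposed_imp => _; apply: exposed_notin.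
apply: exposed_ext (exposedI (exposedI exp_in exp_notin)
                             (exposedI (exp_up (J :\: I)) (exp_up (K :\: J)))).
move=> D dD; split=> [[[ID DK] [upIJ upJK]]|].
  have [i j iS jS ij|nIJ|sIJ] := connected_block cIJ dD.
  - by apply: upIJ; rewrite iS jS.
  - have [i j iS jS ij|nJK|sJK] := connected_block cJK dD.
    + by apply: upJK; rewrite iS jS.
    + suff -> : D = I by rewrite !inE eqxx.
      apply/setP => i; apply/idP/idP => [iD|]; last exact: ID.
      have iK : i \in K by apply: contraLR iD; apply: DK.
      apply: contraLR iD => iI; have [iJ|iJ] := boolP (i \in J).
        by apply: nIJ; rewrite inE iI.
      by apply: nJK; rewrite inE iJ.
    (* The fourth choice: [D] contains [K :\: J] and misses [J :\: I]. Then no comparability links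
       the two blocks, against the connectedness of [K :\: I]. *)
    + have [_ /(_ (K :\: J))] := cIK => /(_ _ cJK.1) H.
      have [_ /set0Pn[i]] := (I, cIJ.1); rewrite inE => /andP[iI iJ].
      suff /setP/(_ i) : K :\: J = K :\: I by rewrite !inE iI iJ (subsetP JK).
      apply: H => [|u v]; first exact: setDS.
      rewrite [u \in _]inE [v \in K :\: I]inE => /andP[uJ uK] /andP[vI vK] uv.
      rewrite inE vK andbT; apply/negP => vJ.
      have vD : v \notin D by apply: nIJ; rewrite inE vI.
      case/orP: uv => uv.
        by case/negP: uJ; apply: (downsetP _ dJ) uv.
      case/negP: vD; apply: (downsetP _ dD) uv; apply: (subsetP sJK).
      by rewrite inE uJ.
  - have [i j iS jS ij|nJK|sJK] := connected_block cJK dD.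
    + by apply: upJK; rewrite iS jS.
    + suff -> : D = J by rewrite !inE eqxx orbT.
      apply/setP => i; apply/idP/idP => [iD|iJ].
        have iK : i \in K by apply: contraLR iD; apply: DK.
        by apply: contraLR iD => iJ; apply: nJK; rewrite inE iJ.
      have [/ID //|iI] := boolP (i \in I).
      by apply: (subsetP sIJ); rewrite inE iI.
    + suff -> : D = K by rewrite !inE eqxx !orbT.
      apply/setP => i; apply/idP/idP => [iD|iK].
        by apply: contraLR iD; apply: DK.
      have [/ID //|iI] := boolP (i \in I).
      have [iJ|iJ] := boolP (i \in J).
        by apply: (subsetP sIJ); rewrite inE iI.
      by apply: (subsetP sJK); rewrite inE iJ.
have upD S S' D' : D' \subset S \/ S' \subset D' -> up (S' :\: S) D'.
  move=> H i j; rewrite !inE => /and3P[/andP[iS _] /andP[_ jS'] _] iD.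
  case: H => /subsetP H; last exact: H.
  by rewrite H in iS.
rewrite !inE => /orP[/orP[]|] /eqP->; do ![split]; move=> //;
  try (by move=> i; apply/subsetP); try (by move=> i; apply/contraNN/subsetP);
  by apply: upD; auto.
Qed.

(** Two exchanges: trading [I] and [J] for their intersection and union shows that they are nested;
    moving a union [U] of components of the difference from [J] to [I] shows that [U] is the whole
    difference. *)
Lemma linked_exposed3 G I J : G \in exposed3 R (downsets T) -> I \in G -> J \in G ->
  I != J -> linked I J \/ linked J I.
Proof.
move=> Gexp IG JG IJ.
have /subsetP GF : G \subset downsets T.
  by move: Gexp; rewrite inE => /andP[/andP[]].
wlog sub : I J IG JG IJ / I \subset J.
  move=> H; have /downsetP dI := GF _ IG; have /downsetP dJ := GF _ JG.
  have [] := exposed3_swap Gexp IG JG IJ (S := I :&: J) (S' := I :|: J).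
  - apply/downsetP => i j; rewrite !inE => /andP[iI iJ] ji.
    by rewrite (dI _ _ iI ji) (dJ _ _ iJ ji).
  - apply/downsetP => i j; rewrite !inE => /orP[iI|iJ] ji; first by rewrite (dI _ _ iI ji).
    by rewrite (dJ _ _ iJ ji) orbT.
  - by apply/setP => i; rewrite !inE; case: (i \in I); case: (i \in J).
  - by apply/setP => i; rewrite !inE; case: (i \in I); case: (i \in J).
  - by move/setIidPl; apply: H.
  - rewrite eq_sym in IJ; move/setIidPr => JI.
    by case: (H _ _ JG IG IJ JI); [right|left].
left; split=> //; split.
  by apply: contraNneq IJ => /eqP; rewrite setD_eq0 => JI; rewrite eqEsubset sub.
move=> U UJI U0 Ucl; have /downsetP dI := GF _ IG; have /downsetP dJ := GF _ JG.
have UJ u : u \in U -> u \notin I /\ u \in J.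
  by move/(subsetP UJI); rewrite inE => /andP[].
have IJi i : i \in I -> i \in J by apply/subsetP.
(* Both new sets are down-sets because [U] is closed under comparability in [J :\: I]. *)
have [] := exposed3_swap Gexp IG JG IJ (S := I :|: U) (S' := J :\: U).
- apply/downsetP => i j; rewrite !inE => /orP[iI|iU] ji; first by rewrite (dI _ _ iI ji).
  have [//|jI /=] := boolP (j \in I); apply: (Ucl i) => //; last first.
    by rewrite /Order.comparable ji orbT.
  by rewrite inE jI (dJ _ _ (UJ i iU).2 ji).
- apply/downsetP => i j; rewrite !inE => /andP[iU iJ] ji; rewrite (dJ _ _ iJ ji) andbT.
  apply: contraNN iU => jU; apply: (Ucl j) => //; last by rewrite /Order.comparable ji.
  by rewrite inE iJ andbT; apply: contraNN (UJ j jU).1 => iI; apply: dI ji.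
- apply/setP => i; rewrite !inE; have := UJ i; have := IJi i.
  by case: (i \in I); case: (i \in J); case: (i \in U) => //= H H'; have [] := H' isT.
- apply/setP => i; rewrite !inE; have := UJ i; have := IJi i.
  by case: (i \in I); case: (i \in J); case: (i \in U) => //= H H'; have [] := H' isT.
- move/setP => E; case/set0Pn: U0 => u uU; have := E u.
  by rewrite !inE uU orbT; have [/negbTE->] := UJ u uU.
- move/setP => E; apply/eqP; rewrite eqEsubset UJI; apply/subsetP => i.
  by rewrite inE => /andP[/negbTE iI iJ]; have := E i; rewrite !inE iI iJ.
Qed.

End OrderPolytopeTriangles.

(** * Triangles as transitive triples *)

Section Triangles.
Variables (S S' : finType) (e : rel S) (W : {set S}).

Definition triangles : {set S * S * S} :=
  [set t | [&& t.1.1 \in W, t.1.2 \in W, t.2 \in W, e t.1.1 t.1.2,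
              e t.1.2 t.2 & e t.1.1 t.2]].

(* [mu] makes [e] acyclic, so a triangle of the underlying graph is a single
   transitive triple *)
Lemma card_triangles (mu : S -> nat) (F : {set {set S'}}) (phi : S -> S') :
  {in W &, injective phi} ->
  {in W &, forall x y, e x y -> mu x < mu y} ->
  (forall x y z, x \in W -> y \in W -> z \in W -> e x y -> e y z -> e x z ->
     [set phi x; phi y; phi z] \in F) ->
  (forall G, G \in F -> #|G| = 3 /\ G \subset phi @: W) ->
  (forall G x y, G \in F -> x \in W -> y \in W -> phi x \in G -> phi y \in G ->
     x != y -> e x y \/ e y x) ->
  #|F| = #|triangles|.
Proof.
move=> phiI emu triF F3 Fe.
pose f (t : S * S * S) := [set phi t.1.1; phi t.1.2; phi t.2].
suff -> : F = f @: triangles.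
  apply: card_in_imset => -[[x y] z] -[[x' y'] z'].
  rewrite !inE /f /= => /and5P[xW yW zW exy /andP[eyz exz]].
  move=> /and5P[xW' yW' zW' exy' /andP[eyz' exz']] E.
  (* Each of [x'], [y'], [z'] is one of [x], [y], [z]; as [mu] increases along both triples, they
     match in order. *)
  have mem u : u \in W -> phi u \in [set phi x; phi y; phi z] -> [|| u == x, u == y | u == z].
    move=> uW; rewrite !inE => /orP[/orP[]|] /eqP/phiI => ->; rewrite ?eqxx ?orbT //.
  have mx' := mem x' xW'; have my' := mem y' yW'; have mz' := mem z' zW'.
  rewrite E !inE eqxx in mx'; rewrite E !inE eqxx orbT in my'.
  rewrite E !inE eqxx orbT in mz'.
  have lxy := emu _ _ xW yW exy; have lyz := emu _ _ yW zW eyz.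
  have lxy' := emu _ _ xW' yW' exy'; have lyz' := emu _ _ yW' zW' eyz'.
  move: lxy lyz lxy' lyz' (mx' isT) (my' isT) (mz' isT); clear=> lxy lyz lxy' lyz'.
  move=> /or3P[] /eqP ex /or3P[] /eqP ey /or3P[] /eqP ez; rewrite ex ey ez // in lxy' lyz' *;
  exfalso; clear -lxy lyz lxy' lyz'; lia.
apply/setP => G; apply/idP/imsetP => [GF|[[[x y] z]]]; last first.
  by rewrite inE /= => /and5P[xW yW zW exy /andP[eyz exz]] ->; apply: triF.
have [/cards3P[A [B [C [AB AC BC GE]]]] /subsetP GW] := F3 G GF.
have mem U : U \in [set A; B; C] -> exists2 x, x \in W & U = phi x.
  by rewrite -GE => /GW/imsetP.
have [|x xW Ax] := mem A; first by rewrite !inE eqxx.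
have [|y yW By] := mem B; first by rewrite !inE eqxx orbT.
have [|z zW Cz] := mem C; first by rewrite !inE eqxx orbT.
subst A B C.
have adj u v : u \in W -> v \in W -> phi u \in G -> phi v \in G -> phi u != phi v ->
    e u v \/ e v u.
  move=> uW vW uG vG uv; apply: (Fe G) => //; by apply: contraNneq uv => ->.
have xG : phi x \in G by rewrite GE !inE eqxx.
have yG : phi y \in G by rewrite GE !inE eqxx orbT.
have zG : phi z \in G by rewrite GE !inE eqxx orbT.
have H a b c : a \in W -> b \in W -> c \in W -> e a b -> e b c -> e a c ->
    G = [set phi a; phi b; phi c] -> exists2 t, t \in triangles & G = f t.
  by move=> aW bW cW ab bc ac GE'; exists (a, b, c) => //; rewrite inE /= aW bW cW ab bc ac.
have cyc a b c : a \in W -> b \in W -> c \in W -> e a b -> e b c -> e c a -> False.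
  move=> aW bW cW /emu lab /emu lbc /emu lca.
  by have := ltn_trans (ltn_trans (lab aW bW) (lbc bW cW)) (lca cW aW); rewrite ltnn.
have perm u v w : G = [set phi u; phi v; phi w] -> G = [set phi u; phi w; phi v] /\
    G = [set phi v; phi u; phi w].
  by move=> ->; split; apply/setP => t; rewrite !inE;
  case: (t == phi u); case: (t == phi v); case: (t == phi w).
have [Gxzy Gyxz] := perm _ _ _ GE; have [Gyzx _] := perm _ _ _ Gyxz.
have [_ Gzxy] := perm _ _ _ Gxzy; have [Gzyx _] := perm _ _ _ Gzxy.
(* Six of the eight orientations are transitive; the two cyclic ones contradict [mu]. *)
case: (adj x y) => // exy; case: (adj y z) => // eyz; case: (adj x z) => // exz.
- exact: (H x y z).
- by case: (cyc x y z).
- exact: (H x z y).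
- exact: (H z x y).
- exact: (H y x z).
- exact: (H y z x).
- by case: (cyc x z y).
- exact: (H z y x).
Qed.

End Triangles.

Lemma card_triangles_sum (S : finType) (e : rel S) (W : {set S}) :
  #|triangles e W| =
  \sum_(z in W) \sum_(y in W | e y z) #|[set x in W | e x y & e x z]|.
Proof.
rewrite -sum1_card big_mkcond /=.
transitivity (\sum_p \sum_z (((p.1, p.2), z) \in triangles e W : nat)).
  by rewrite pair_bigA; apply: eq_bigr => -[[x y] z] _ /=; case: ifP.
rewrite exchange_big /=.
transitivity (\sum_z \sum_y \sum_x (((x, y), z) \in triangles e W : nat)).
  by apply: eq_bigr => z _; rewrite [RHS]exchange_big pair_bigA.
rewrite [RHS]big_mkcond; apply: eq_bigr => z _ /=.
case: ifPn => zW; last first.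
  by rewrite big1 // => y _; rewrite big1 // => x _; rewrite inE /= (negbTE zW) !andbF.
rewrite [RHS]big_mkcond; apply: eq_bigr => y _ /=.
rewrite -sum1_card big_mkcond /=.
case: ifPn => [/andP[yW yz]|H]; last first.
  rewrite big1 // => x _; rewrite inE /= zW; move: H; rewrite negb_and.
  by case/orP => /negbTE->; rewrite ?andbF.
by rewrite [RHS]big_mkcond; apply: eq_bigr => x _; rewrite !inE /= yW zW yz /=;
  case: (x \in W); case: (e x y); case: (e x z).
Qed.

(** * The order determined by the rank *)

Lemma rank_homo (disp : Order.disp_t) (T : finPOrderType disp) (i j : T) :
  (i < j)%O -> rank i < rank j.
Proof.
(* Putting [j] on top of a chain ending in [i] adds one element, which offsets the predecessor in
   [rank]. *)
move=> ij; have le_rank (C : {set T}) : is_chain C -> i \in C ->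
    {in C, forall k, (k <= i)%O} -> #|C| <= rank j.
  move=> /chainP chC iC leC; have jC : j \notin C.
    by apply/negP => /leC; rewrite lt_geF.
  have ltC k : k \in C -> (k <= j)%O by move=> /leC ki; apply: le_trans ki (ltW ij).
  have -> : #|C| = #|j |: C|.-1 by rewrite cardsU1 jC.
  apply: (@leq_bigmax_cond _ _ (fun C : {set T} => #|C|.-1)).
  rewrite setU11 andbT; apply/andP; split; last first.
    by apply/forall_inP => k; rewrite !inE => /predU1P[->|/ltC].
  apply/chainP => k l; rewrite !in_setU1 => /predU1P[->|kC] /predU1P[->|lC].
  - exact: comparablexx.
  - by rewrite /Order.comparable ltC ?orbT.
  - by rewrite /Order.comparable ltC.
  - exact: chC.
have rank_gt0 : 0 < rank j.
  apply: leq_trans (le_rank [set i] _ _ _); rewrite ?cards1 ?set11 //.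
    by apply/chainP => k l; rewrite !inE => /eqP-> /eqP->; apply: comparablexx.
  by move=> k /set1P->.
rewrite -(prednK rank_gt0) ltnS; apply/bigmax_leqP => C /andP[/andP[chC iC] /forall_inP leC].
by rewrite -!subn1 leq_sub2r // le_rank.
Qed.

(** The form in which the hypothesis on the poset enters the rest: distinct elements are
    incomparable exactly when their ranks agree. *)
Lemma maximal_ranked_lt (disp : Order.disp_t) (T : finPOrderType disp) :
  maximal_ranked T -> forall i j : T, (i < j)%O = (rank i < rank j).
Proof.
move=> [_ cmp] i j; apply/idP/idP => [/rank_homo//|lt_ij].
have neq_ij : rank i <> rank j by move=> E; rewrite E ltnn in lt_ij.
case/orP: (cmp i j neq_ij); rewrite le_eqVlt => /orP[/eqP E|//].
  by rewrite E ltnn in lt_ij.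
  by rewrite E ltnn in lt_ij.
by move/rank_homo; rewrite ltnNge ltnW.
Qed.

(** * Antichains as codes for down-sets *)

Section DownClosure.
Variables (disp : Order.disp_t) (T : finPOrderType disp).
Implicit Types (A B C D : {set T}) (i j k : T).

Definition down A : {set T} := [set i | [exists j in A, (i <= j)%O]].
Definition maxs D : {set T} := [set i in D | [forall j in D, ~~ (i < j)%O]].
(** For empty [B] this is the whole poset, whence the condition [B != set0] when it is compared with
    [below]. *)
Definition lower B : {set T} := [set i | [forall j in B, (i < j)%O]].

Lemma downP A i : reflect (exists2 j, j \in A & (i <= j)%O) (i \in down A).
Proof. by rewrite inE; apply: exists_inP. Qed.

Lemma maxsP D i :
  reflect (i \in D /\ forall j, j \in D -> ~~ (i < j)%O) (i \in maxs D).
Proof. by rewrite inE; apply: (iffP andP) => -[iD /forall_inP]. Qed.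

Lemma lowerP B i : reflect (forall j, j \in B -> (i < j)%O) (i \in lower B).
Proof. by rewrite inE; apply: forall_inP. Qed.

Lemma down_downset A : down A \in downsets T.
Proof.
apply/downsetP => i j /downP[k kA ik] ji; apply/downP; exists k => //.
exact: le_trans ik.
Qed.

Lemma lower_downset B : lower B \in downsets T.
Proof.
by apply/downsetP => i j /lowerP iB ji; apply/lowerP => k /iB; apply: le_lt_trans.
Qed.

Lemma sub_down A : A \subset down A.
Proof. by apply/subsetP => i iA; apply/downP; exists i. Qed.

Lemma maxs_antichain D : maxs D \in antichains T.
Proof. by apply/antichainP => i j /maxsP[_ imax] /maxsP[jD _]; apply: imax. Qed.

(** Together with [maxs_down], this makes [down] and [maxs] inverse bijections between antichains
    and down-sets. *)
Lemma down_maxs D : D \in downsets T -> down (maxs D) = D.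
Proof.
move=> /downsetP dD; apply/setP => i; apply/downP/idP => [[j /maxsP[jD _]]|iD].
  exact: dD.
have [j [jD ij jmax]] := @maximal_above _ T (mem D) i iD.
by exists j => //; apply/maxsP.
Qed.

Lemma maxs_down A : A \in antichains T -> maxs (down A) = A.
Proof.
move=> /antichainP antiA; apply/setP => i; apply/maxsP/idP => [[/downP[j jA ij] imax]|iA].
  move: ij; rewrite le_eqVlt => /orP[/eqP->//|].
  by rewrite (negbTE (imax j _)) // (subsetP (sub_down A)).
split=> [|j /downP[k kA jk]]; first exact: (subsetP (sub_down A)).
by apply: contraNN (antiA i k iA kA) => /lt_le_trans; apply.
Qed.

Lemma down_inj : {in antichains T &, injective down}.
Proof. by move=> A B antiA antiB E; rewrite -(maxs_down antiA) E maxs_down. Qed.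

Lemma connected1 i : connected [set i].
Proof.
split=> [|U]; first by apply/set0Pn; exists i; rewrite set11.
by rewrite subset1 => /orP[/eqP-> //|/eqP->]; rewrite eqxx.
Qed.

(** In an antichain every singleton is closed under comparability. *)
Lemma connected_antichain A : A \in antichains T -> connected A -> #|A| = 1.
Proof.
move=> /antichainP antiA [/set0Pn[i iA] conA]; suff <- : [set i] = A by rewrite cards1.
apply: conA => [||j k /set1P-> kA]; first by rewrite sub1set.
  by apply/set0Pn; exists i; rewrite set11.
rewrite inE; case/orP; rewrite le_eqVlt.
  by rewrite (negbTE (antiA _ _ iA kA)) orbF eq_sym.
by rewrite (negbTE (antiA _ _ kA iA)) orbF.
Qed.

(** A set closed under comparability spreads from a point of one part to the whole other part, and
    from there back. *)
Lemma connected_join A B : A != set0 -> B != set0 ->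
  (forall i j, i \in A -> j \in B -> (i < j)%O) -> connected (A :|: B).
Proof.
move=> /set0Pn[a aA] /set0Pn[b bB] AB; split=> [|U UAB /set0Pn[u uU] Ucl].
  by apply/set0Pn; exists a; rewrite inE aA.
have cmp i j : i \in A -> j \in B -> (i >=< j)%O /\ (j >=< i)%O.
  by move=> iA jB; rewrite /Order.comparable (ltW (AB i j iA jB)) orbT.
have UA i : i \in U -> i \in A -> B \subset U.
  move=> iU iA; apply/subsetP => j jB; apply: (Ucl i) => //; first by rewrite inE jB orbT.
  exact: (cmp i j iA jB).1.
have UB j : j \in U -> j \in B -> A \subset U.
  move=> jU jB; apply/subsetP => i iA; apply: (Ucl j) => //; first by rewrite inE iA.
  exact: (cmp i j iA jB).2.
apply/eqP; rewrite eqEsubset UAB subUset /=; apply/andP.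
have := subsetP UAB u uU; rewrite inE => /orP[uA|uB].
  have BU := UA u uU uA; split=> //.
  by apply: (UB b) => //; apply: (subsetP BU).
have AU := UB u uU uB; split=> //.
by apply: (UA a) => //; apply: (subsetP AU).
Qed.

(** The condition on [B] keeps antichains from being vacuously below the empty one; an empty [A] is
    allowed. *)
Definition below A B : bool :=
  (B != set0) && [forall i in A, forall j in B, (i < j)%O].

(** The condition on [A] makes [covers] and [below] exclusive: the pair of [set0] and a singleton
    falls under [below]. *)
Definition covers A B : bool := [&& A != set0, A \subset B & #|B :\: A| == 1].

(* For antichains of a poset whose incomparability is an equivalence relation,
   [arrow (fun=> set0)] and [arrow (maxs \o lower)] are the adjacency relations
   of the chain and the order polytope; they differ only in the one antichain
   [p B] below [B] that is not adjacent to [B] when [B] has several elements. *)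
Definition arrow (p : {set T} -> {set T}) A B : bool :=
  covers A B || below A B && ((A != p B) || (#|B| == 1)).

Lemma belowP A B :
  reflect (B != set0 /\ forall i j, i \in A -> j \in B -> (i < j)%O) (below A B).
Proof.
apply: (iffP andP) => -[B0 H]; split=> //.
  by move=> i j iA jB; apply: (forall_inP (forall_inP H i iA)).
by apply/forall_inP => i iA; apply/forall_inP => j; apply: H.
Qed.

Lemma coversP A B :
  reflect (A != set0 /\ exists2 b, b \notin A & B = b |: A) (covers A B).
Proof.
apply: (iffP and3P) => [[A0 AB /cards1P[b E]]|[A0 [b bA ->]]]; split=> //.
- exists b; last by rewrite -(setID B A) E (setIidPr AB) setUC.
  by have := set11 b; rewrite -E inE => /andP[].
- exact: subsetUr.
- rewrite setDUl setDv setU0; apply/cards1P; exists b.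
  by apply/setDidPl; rewrite disjoints1.
Qed.

End DownClosure.

(** * Adjacency of antichains in a weak order *)

Section WeakOrder.
Variables (disp : Order.disp_t) (T : finPOrderType disp) (r : T -> nat).
Hypothesis ltr : forall i j : T, (i < j)%O = (r i < r j).
Implicit Types (A B C D : {set T}) (i j k : T).

Lemma antichain_rank A i j : A \in antichains T -> i \in A -> j \in A -> r i = r j.
Proof.
move=> /antichainP antiA iA jA; apply/eqP; rewrite eqn_leq.
by rewrite leqNgt -ltr antiA // leqNgt -ltr antiA.
Qed.

(** An antichain lies in a single rank, so one member [b] speaks for all of [B]; [mem_lower] holds
    for the same reason. *)
Lemma mem_down B b i : B \in antichains T -> b \in B ->
  (i \in down B) = (i \in B) || (i < b)%O.
Proof.
move=> antiB bB; apply/downP/orP => [[j jB]|[iB|ib]].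
- rewrite le_eqVlt => /predU1P[->|]; first by left.
  by rewrite !ltr (antichain_rank antiB jB bB); right.
- by exists i.
- by exists b => //; apply: ltW.
Qed.

Lemma mem_lower B b i : B \in antichains T -> b \in B -> (i \in lower B) = (i < b)%O.
Proof.
move=> antiB bB; apply/lowerP/idP => [->//|ib j jB].
by rewrite ltr (antichain_rank antiB jB bB) -ltr.
Qed.

Lemma below_neq A B i j : below A B -> i \in A -> j \in B -> i != j.
Proof. by move=> /belowP[_ AB] iA jB; rewrite lt_eqF // AB. Qed.

Lemma below_lower A B : B != set0 -> below A B = (A \subset lower B).
Proof.
move=> B0; apply/belowP/subsetP => [[_ AB] i iA|AB].
  by apply/lowerP => j; apply: AB.
by split=> // i j /AB/lowerP; apply.
Qed.

(** Supplies the measure [#|down A|] that makes arrows acyclic. *)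
Lemma arrow_proper p A B : A \in antichains T -> B \in antichains T -> arrow p A B ->
  down A \proper down B.
Proof.
move=> antiA antiB /orP[/coversP[/set0Pn[a aA] [b bA BE]]|/andP[/belowP[/set0Pn[b bB] AB] _]].
  have aB : a \in B by rewrite BE inE aA orbT.
  have bB : b \in B by rewrite BE setU11.
  apply/properP; split.
    apply/subsetP => i; rewrite (mem_down _ antiA aA) (mem_down _ antiB aB) BE in_setU1.
    by case/orP=> ->; rewrite !orbT.
  exists b; first by rewrite (mem_down _ antiB bB) bB.
  by rewrite (mem_down _ antiA aA) negb_or bA (antichainP _ antiB).
apply/properP; split.
  apply/subsetP => i /downP[a aA ia]; rewrite (mem_down _ antiB bB).
  by rewrite (le_lt_trans ia (AB _ _ aA bB)) orbT.
exists b; first by rewrite (mem_down _ antiB bB) bB.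
by apply/downP => -[a aA]; rewrite lt_geF ?AB.
Qed.

(** If [B] is [A] plus an element, the down-sets differ by that element. If [A] is below [B], the
    difference is [B] on top of [lower B :\: down A], which is connected when the latter is
    nonempty. It is empty exactly for [A = maxs (lower B)]; then [B] alone is left, connected only
    as a singleton. *)
Lemma arrow_linked A B : A \in antichains T -> B \in antichains T ->
  arrow (maxs (T:=T) \o lower (T:=T)) A B <-> linked (down A) (down B).
Proof.
move=> antiA antiB; split.
  move=> AB; split; first exact: (proper_sub (arrow_proper antiA antiB AB)).
  case/orP: AB => [/coversP[/set0Pn[a aA] [b bA BE]]|/andP[AB AB1]].
    have aB : a \in B by rewrite BE inE aA orbT.
    have bB : b \in B by rewrite BE setU11.
    suff -> : down B :\: down A = [set b] by apply: connected1.
    apply/setP => i; rewrite in_setD (mem_down _ antiA aA) (mem_down _ antiB aB) in_set1.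
    rewrite negb_or BE in_setU1; have [->|ib] := eqVneq i b.
      by rewrite bA (antichainP _ antiB).
    by case: (i \in A); case: (i < a)%O.
  have /belowP[/set0Pn[b bB] ltAB] := AB.
  have DE : down B :\: down A = (lower B :\: down A) :|: B.
    apply/setP => i; rewrite in_setU !in_setD (mem_down _ antiB bB) (mem_lower _ antiB bB).
    have [iB|_] := boolP (i \in B); last by rewrite orbF.
    rewrite andbT orbT; apply/downP => -[a aA]; by rewrite lt_geF ?ltAB.
  rewrite DE; have [L0|L0] := eqVneq (lower B :\: down A) set0.
    rewrite L0 set0U; suff AE : A = maxs (lower B).
      by move: AB1; rewrite /= -AE eqxx => /cards1P[c ->]; apply: connected1.
    rewrite -[LHS]maxs_down //; congr maxs; apply/eqP; rewrite eqEsubset.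
    rewrite -[X in _ && X]setD_eq0 L0 eqxx andbT.
    apply/subsetP => i /downP[a aA ia]; apply/lowerP => j jB.
    exact: le_lt_trans ia (ltAB _ _ aA jB).
  apply: connected_join => // [|i j]; first by apply/set0Pn; exists b.
  by rewrite in_setD => /andP[_ /lowerP iB] /iB.
case=> /subsetP sAB conD; have [b bB] : exists b, b \in B.
  have [/set0Pn[i]] := conD; rewrite inE => /andP[_ /downP[b bB _]] _; by exists b.
have B0 : B != set0 by apply/set0Pn; exists b.
have AB a : a \in A -> (a \in B) || (a < b)%O.
  by move=> aA; rewrite -mem_down // sAB // (subsetP (sub_down A)).
have below_arrow : below A B -> arrow (maxs (T:=T) \o lower (T:=T)) A B.
  move=> bAB; rewrite /arrow bAB /=; apply/orP; right.
  have [AE|//] := eqVneq A (maxs (lower B)); apply/eqP/connected_antichain => //.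
  suff <- : down B :\: down A = B by [].
  rewrite AE down_maxs ?lower_downset //; apply/setP => i.
  rewrite in_setD (mem_down _ antiB bB) (mem_lower _ antiB bB).
  have [iB|_] := boolP (i \in B); last by case: (i < b)%O.
  by rewrite (antichainP _ antiB).
have [A0|[a aA]] := set_0Vmem A.
  by apply/below_arrow/belowP; split=> // i j; rewrite A0 inE.
case/orP: (AB a aA) => [aB|ab]; last first.
  apply/below_arrow/belowP; split=> // i j iA jB.
  by rewrite ltr (antichain_rank antiA iA aA) (antichain_rank antiB jB bB) -ltr.
(* A shared element puts [A] and [B] in one rank, so the down-sets differ by the antichain
   [B :\: A]. *)
have subAB : A \subset B.
  apply/subsetP => i iA; move: (AB i iA); rewrite ltr (antichain_rank antiA iA aA).
  by rewrite (antichain_rank antiB aB bB) ltnn orbF.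
rewrite /arrow /covers subAB; apply/orP; left; apply/andP; split.
  by apply/set0Pn; exists a.
have EBA : down B :\: down A = B :\: A.
  apply/setP => i.
  rewrite !in_setD (mem_down _ antiB aB) (mem_down _ antiA aA).
  have [ia|_] := boolP (i < a)%O; last by rewrite !orbF.
  rewrite !orbT /=; apply/esym/negbTE; rewrite negb_and; apply/orP; right.
  by apply: contraL ia => iB; apply: (antichainP _ antiB).
apply/eqP/connected_antichain; last by rewrite -EBA.
apply/antichainP => i j; by rewrite !inE => /andP[_ iB] /andP[_ jB]; apply: (antichainP _ antiB).
Qed.

Lemma antichain_below_split D A B : D \in antichains T -> below A B ->
  D \subset A :|: B -> D \subset A \/ D \subset B.
Proof.
move=> /antichainP antiD /belowP[_ AB] /subsetP DAB.
have [?|/subsetPn[d dD dA]] := boolP (D \subset A); first by left.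
right; apply/subsetP => i iD; have := DAB i iD; rewrite inE => /orP[iA|//].
have := DAB d dD; rewrite inE (negbTE dA) /= => dB.
by have := antiD _ _ iD dD; rewrite AB.
Qed.

(** * Triangular faces of the chain polytope *)

Lemma chain3 i j k : (i <= j)%O -> (j <= k)%O -> is_chain [set i; j; k].
Proof.
move=> ij jk; have ik := le_trans ij jk; apply/chainP => u v.
rewrite !inE => /orP[/orP[]|] /eqP-> /orP[/orP[]|] /eqP->;
  by rewrite /Order.comparable ?lexx ?ij ?jk ?ik ?orbT.
Qed.

(** These are the chains whose inequality is tight at all three antichains. *)
Definition transversal A B C (S : {set T}) : bool :=
  [&& is_chain S, A :&: S != set0, B :&: S != set0 & C :&: S != set0].

Local Notation arrow0 := (arrow (fun=> set0)).

(** Chains [[set i; j; k]] suffice. As an antichain, [D] stays within one level; the chains force it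
    to contain that level or, when two of the antichains differ by one element, the smaller of the
    two. An empty [A] admits no transversal and is treated apart: [B] and [C] are then comparable
    singletons. *)
Lemma arrow0_transversal A B C D :
  A \in antichains T -> B \in antichains T -> C \in antichains T -> D \in antichains T ->
  arrow0 A B -> arrow0 B C -> arrow0 A C ->
  D \subset A :|: B :|: C -> (forall S, transversal A B C S -> D :&: S != set0) ->
  D \in [set A; B; C].
Proof.
move=> antiA antiB antiC antiD aAB aBC aAC DABC Dmeet; rewrite !inE.
have meet i j k : (i <= j)%O -> (j <= k)%O -> A :&: [set i; j; k] != set0 ->
    B :&: [set i; j; k] != set0 -> C :&: [set i; j; k] != set0 ->
    [|| i \in D, j \in D | k \in D].
  move=> ij jk mA mB mC; have := Dmeet [set i; j; k].
  rewrite /transversal chain3 // mA mB mC => /(_ isT) /set0Pn[l].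
  by rewrite !inE => /andP[lD /orP[/orP[]|] /eqP <-]; rewrite lD ?orbT.
have in3 (E : {set T}) (i j k l : T) : l \in E -> l \in [set i; j; k] ->
    E :&: [set i; j; k] != set0.
  by move=> lE lS; apply/set0Pn; exists l; rewrite inE lE.
have [A0|[a0 a0A]] := set_0Vmem A.
  have card1 E : arrow0 A E -> #|E| = 1.
    by rewrite A0 /arrow /covers eqxx /= => /andP[_ /eqP].
  have [/eqP/cards1P[b BE] /eqP/cards1P[c CE]] := (card1 B aAB, card1 C aAC).
  have bc : (b < c)%O.
    case/orP: aBC => [/coversP[_ [x xB CxB]]|/andP[/belowP[_ ltBC] _]].
      by move: (card1 C aAC); rewrite CxB cardsU1 xB (card1 B aAB).
    by apply: ltBC; rewrite ?BE ?CE set11.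
  have bcD := antichainP _ antiD b c.
  have DE i : i \in D -> (i == b) || (i == c).
    by move/(subsetP DABC); rewrite A0 BE CE !inE.
  rewrite A0 BE CE; have [bD|bD] := boolP (b \in D).
    apply/orP; left; apply/orP; right; apply/eqP/setP => i; rewrite inE.
    apply/idP/eqP => [iD|->//]; case/orP: (DE i iD) => /eqP // ic.
    by rewrite ic in iD; move: (bcD bD iD); rewrite bc.
  have [cD|cD] := boolP (c \in D).
    apply/orP; right; apply/eqP/setP => i; rewrite inE.
    apply/idP/eqP => [iD|->//]; case/orP: (DE i iD) => /eqP // ib.
    by rewrite -ib iD in bD.
  apply/orP; left; apply/orP; left; apply/eqP/setP => i; rewrite inE; apply/negP => iD.
  by case/orP: (DE i iD) => /eqP E; rewrite E in iD; rewrite iD in bD cD.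
have subD (E F : {set T}) : E \subset D -> D \subset F -> #|F :\: E| = 1 ->
    E \subset F -> D = E \/ D = F.
  move=> ED DF /eqP/cards1P[x FE] EF.
  have [xD|xD] := boolP (x \in D); [right|left]; apply/eqP; rewrite eqEsubset ?DF ?ED ?andbT /=.
    apply/subsetP => i iF; have [/(subsetP ED)//|iE] := boolP (i \in E).
    have : i \in F :\: E by rewrite inE iE.
    by rewrite FE inE => /eqP->.
  apply/subsetP => i iD; have [//|iE] := boolP (i \in E).
  have : i \in F :\: E by rewrite inE iE (subsetP DF).
  by rewrite FE inE => /eqP E'; rewrite -E' iD in xD.
have notin E F i : below E F -> D \subset E -> i \in F -> i \notin D.
  move=> EF DE iF; apply/negP => /(subsetP DE) iE.
  by have := below_neq EF iE iF; rewrite eqxx.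
have notin' E F i : below E F -> D \subset F -> i \in E -> i \notin D.
  move=> EF DF iE; apply/negP => /(subsetP DF) iF.
  by have := below_neq EF iE iF; rewrite eqxx.
have A0 : A != set0 by apply/set0Pn; exists a0.
(* Two covers in a row are impossible: [C] would contain the nonempty [A] and have two more
   elements, so no arrow could join [A] to [C]. *)
case/orP: aAB => [/and3P[_ sAB /eqP cAB]|/andP[bAB _]];
  case/orP: aBC => [/and3P[B0 sBC /eqP cBC]|/andP[bBC _]].
- case/orP: aAC => [/and3P[_ sAC /eqP cAC]|/andP[bAC _]].
    have := cardsD B A; have := cardsD C B; have := cardsD C A.
    rewrite cAB cBC cAC (setIidPr sAB) (setIidPr sAC) (setIidPr sBC).
    have := subset_leq_card sAB; have := subset_leq_card sBC; clear; lia.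
  have := below_neq bAC a0A (subsetP sBC _ (subsetP sAB _ a0A)).
  by rewrite eqxx.
- have /belowP[/set0Pn[c0 c0C] ltBC] := bBC.
  have AC i k : i \in A -> k \in C -> (i \in D) || (k \in D).
    move=> iA kC; have iB := subsetP sAB _ iA.
    have := meet i i k (lexx i) (ltW (ltBC _ _ iB kC)).
    rewrite orbA orbb; apply;
      [apply: (in3 _ _ _ _ i)|apply: (in3 _ _ _ _ i)|apply: (in3 _ _ _ _ k)];
      by rewrite // !inE eqxx ?orbT.
  have [|DB|DC] := antichain_below_split antiD bBC.
  + by move: DABC; rewrite (setUidPr sAB).
  + have [|->|->] := subD A B _ DB cAB sAB; rewrite ?eqxx ?orbT //.
    apply/subsetP => i iA; have := AC i c0 iA c0C.
    by rewrite (negbTE (notin _ _ _ bBC DB c0C)) orbF.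
  + apply/orP; right; rewrite eqEsubset DC; apply/subsetP => k kC.
    have := AC a0 k a0A kC.
    by rewrite (negbTE (notin' _ _ _ bBC DC (subsetP sAB _ a0A))).
- have /belowP[_ ltAB] := bAB; have [b0 b0B] := set0Pn _ B0.
  have bAC : below A C.
    case/orP: aAC => [/and3P[_ sAC _]|/andP[] //].
    have := antichainP _ antiC a0 b0 (subsetP sAC _ a0A) (subsetP sBC _ b0B).
    by rewrite ltAB.
  have AB i k : i \in A -> k \in B -> (i \in D) || (k \in D).
    move=> iA kB; have kC := subsetP sBC _ kB.
    have := meet i i k (lexx i) (ltW (ltAB _ _ iA kB)).
    rewrite orbA orbb; apply;
      [apply: (in3 _ _ _ _ i)|apply: (in3 _ _ _ _ k)|apply: (in3 _ _ _ _ k)];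
      by rewrite // !inE eqxx ?orbT.
  have [|DA|DC] := antichain_below_split antiD bAC.
  + by move: DABC; rewrite -setUA (setUidPr sBC).
  + apply/orP; left; apply/orP; left; rewrite eqEsubset DA; apply/subsetP => i iA.
    have := AB i b0 iA b0B.
    by rewrite (negbTE (notin _ _ _ bAB DA b0B)) orbF.
  + have [|->|->] := subD B C _ DC cBC sBC; rewrite ?eqxx ?orbT //.
    apply/subsetP => k kB; have := AB a0 k a0A kB.
    by rewrite (negbTE (notin' _ _ _ bAC DC a0A)).
- have /belowP[/set0Pn[b0 b0B] ltAB] := bAB; have /belowP[/set0Pn[c0 c0C] ltBC] := bBC.
  have bAC : below A C.
    apply/belowP; split; first by apply/set0Pn; exists c0.
    by move=> i k iA kC; apply: lt_trans (ltAB i b0 iA b0B) (ltBC b0 k b0B kC).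
  have bABC : below (A :|: B) C.
    apply/belowP; split; first by apply/set0Pn; exists c0.
    move=> i k; rewrite inE => /orP[iA|iB] kC; last exact: ltBC.
    by have /belowP[_] := bAC; apply.
  have ABC i j k : i \in A -> j \in B -> k \in C -> [|| i \in D, j \in D | k \in D].
    move=> iA jB kC; apply: (meet i j k (ltW (ltAB _ _ iA jB)) (ltW (ltBC _ _ jB kC)));
    [apply: (in3 _ _ _ _ i)|apply: (in3 _ _ _ _ j)|apply: (in3 _ _ _ _ k)];
      by rewrite // !inE eqxx ?orbT.
  have [//|DAB|DC] := antichain_below_split antiD bABC; last first.
    apply/orP; right; rewrite eqEsubset DC; apply/subsetP => k kC.
    have := ABC a0 b0 k a0A b0B kC.
    by rewrite (negbTE (notin' _ _ _ bAC DC a0A)) (negbTE (notin' _ _ _ bBC DC b0B)).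
  have [//|DA|DB] := antichain_below_split antiD bAB.
    apply/orP; left; apply/orP; left; rewrite eqEsubset DA; apply/subsetP => i iA.
    have := ABC i b0 c0 iA b0B c0C.
    by rewrite (negbTE (notin _ _ _ bAB DA b0B)) (negbTE (notin _ _ _ bAC DA c0C)) !orbF.
  apply/orP; left; apply/orP; right; rewrite eqEsubset DB; apply/subsetP => j jB.
  have := ABC a0 j c0 a0A jB c0C.
  by rewrite (negbTE (notin' _ _ _ bAB DB a0A)) (negbTE (notin _ _ _ bBC DB c0C)) orbF.
Qed.

Variable R : realType.

Lemma exposed3_arrow0 A B C :
  A \in antichains T -> B \in antichains T -> C \in antichains T ->
  arrow0 A B -> arrow0 B C -> arrow0 A C ->
  [set A; B; C] \in exposed3 R (antichains T).
Proof.
move=> antiA antiB antiC aAB aBC aAC; rewrite inE; apply/andP; split; first (apply/andP; split).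
- by apply/subsetP => D; rewrite !in_setU !in_set1 => /orP[/orP[]|] /eqP->.
- have neq E F : E \in antichains T -> F \in antichains T -> arrow0 E F -> E != F.
    move=> antiE antiF aEF; apply/eqP => EF.
    by move: (arrow_proper antiE antiF aEF); rewrite EF properxx.
  by rewrite -setUA cardsU1 cards2 !inE negb_or !neq.
apply/asboolP.
have exp_sub : exposed R (antichains T)
    (fun D => forall i, i \notin A :|: B :|: C -> i \notin D).
  by apply: exposed_forall => i; apply: exposed_imp => _; apply: exposed_notin.
have exp_meet : exposed R (antichains T)
    (fun D => forall S, transversal A B C S -> D :&: S != set0).
  apply: exposed_forall => S; apply: exposed_imp => /and4P[chS _ _ _].
  by apply: exposed_meet => D antiD; apply: card_antichain_chain.
apply: exposed_ext (exposedI exp_sub exp_meet) => D antiD; split=> [[DABC Dmeet]|].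
  apply: arrow0_transversal => //; apply/subsetP => i.
  by apply: contraLR; apply: DABC.
rewrite !inE => /orP[/orP[]|] /eqP->; split=> [i|S /and4P[_ mA mB mC] //];
  by rewrite !inE !negb_or => /andP[/andP[]].
Qed.

(** If one set is empty, splitting an element off the other shows that the other is a singleton. If
    the ranks differ, one set is below the other. If they agree, moving an element [f] from one set
    into the other stays within antichains, so the exchange argument leaves [f] as the only
    difference. *)
Lemma arrow0_exposed3 G A B : G \in exposed3 R (antichains T) -> A \in G -> B \in G ->
  A != B -> arrow0 A B \/ arrow0 B A.
Proof.
move=> Gexp AG BG AB.
have /subsetP GF : G \subset antichains T.
  by move: Gexp; rewrite inE => /andP[/andP[]].
have sub_anti (U V : {set T}) : V \in antichains T -> U \subset V -> U \in antichains T.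
  move=> /antichainP antiV /subsetP UV; apply/antichainP => i j /UV iV /UV jV.
  exact: antiV.
have from_set0 E : E \in G -> set0 \in G -> E != set0 -> arrow0 set0 E.
  move=> EG G0 E0; have [e eE] := set0Pn _ E0.
  apply/orP; right; apply/andP; split; first by apply/belowP; split=> // i j; rewrite inE.
  have [] := exposed3_swap Gexp EG G0 E0 (S := [set e]) (S' := E :\ e).
  - by apply: sub_anti (GF E EG) _; rewrite sub1set.
  - by apply: sub_anti (GF E EG) _; apply: subsetDl.
  - by rewrite setD1K // setU0.
  - by apply/setP => i; rewrite !inE; case: eqP => //=; rewrite andbF.
  - by move=> <-; rewrite cards1 orbT.
  - by move/eqP; rewrite -cards_eq0 cards1.
have [A0|[a aA]] := set_0Vmem A.
  by left; rewrite A0; apply: from_set0; rewrite -?A0 // eq_sym.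
have [B0|[b bB]] := set_0Vmem B.
  by right; rewrite B0; apply: from_set0; rewrite -?B0.
have [antiA antiB] := (GF A AG, GF B BG).
have A0 : A != set0 by apply/set0Pn; exists a.
have B0 : B != set0 by apply/set0Pn; exists b.
have below_arrow E F e f : E \in antichains T -> F \in antichains T ->
    e \in E -> f \in F -> r e < r f -> arrow0 E F.
  move=> antiE antiF eE fF ef; apply/orP; right.
  have E0 : E != set0 by apply/set0Pn; exists e.
  rewrite E0 andbT; apply/belowP; split=> [|i j iE jF]; first by apply/set0Pn; exists f.
  by rewrite ltr (antichain_rank antiE iE eE) (antichain_rank antiF jF fF).
case: (ltngtP (r a) (r b)) => [ab|ba|ab].
- by left; apply: below_arrow aA bB ab.
- by right; apply: below_arrow bB aA ba.
have antiU : A :|: B \in antichains T.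
  apply/antichainP => i j iAB jAB; rewrite ltr -leqNgt.
  have rU k : k \in A :|: B -> r k = r a.
    by rewrite inE => /orP[kA|kB];
      [apply: antichain_rank kA aA|rewrite ab; apply: antichain_rank kB bB].
  by rewrite !rU.
have move_one E F f : E \in G -> F \in G -> E != F -> E != set0 ->
    E :|: F = A :|: B -> f \in F -> f \notin E -> arrow0 E F.
  move=> EG FG EF E0 EU fF fE.
  have [] := exposed3_swap Gexp EG FG EF (S := f |: E) (S' := F :\ f).
  - by apply: sub_anti antiU _; rewrite -EU subUset sub1set inE fF orbT subsetUl.
  - by apply: sub_anti (GF F FG) _; apply: subsetDl.
  - by apply/setP => i; rewrite !inE; have [->|] := eqVneq i f; rewrite ?fF ?orbT.
  - by apply/setP => i; rewrite !inE; have [->|] := eqVneq i f; rewrite ?(negbTE fE).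
  - by move=> E'; rewrite -E' setU11 in fE.
  - by move=> <-; apply/orP; left; apply/coversP; split=> //; exists f.
have [BA|/subsetPn[f fB fA]] := boolP (B \subset A); last first.
  by left; apply: move_one fB fA.
have /subsetPn[f fA fB] : ~~ (A \subset B).
  by apply: contraNN AB => sAB; rewrite eqEsubset sAB.
right; apply: move_one fA fB; rewrite // 1?eq_sym //; exact: setUC.
Qed.

Lemma card_exposed3_chain :
  #|exposed3 R (antichains T)| = #|triangles arrow0 (antichains T)|.
Proof.
apply: (@card_triangles _ _ _ _ (fun A => #|down A|) _ id) => //.
- by move=> A B antiA antiB /(arrow_proper antiA antiB)/proper_card.
- exact: exposed3_arrow0.
- by move=> G; rewrite imset_id inE => /andP[/andP[-> /eqP->]].
- by move=> G A B Gexp _ _; apply: arrow0_exposed3.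
Qed.

Lemma card_exposed3_order : #|exposed3 R (downsets T)| =
  #|triangles (arrow (maxs (T:=T) \o lower (T:=T))) (antichains T)|.
Proof.
apply: (@card_triangles _ _ _ _ (fun A => #|down A|) _ (down (T:=T))).
- exact: down_inj.
- by move=> A B antiA antiB /(arrow_proper antiA antiB)/proper_card.
- move=> A B C antiA antiB antiC /arrow_linked lAB /arrow_linked lBC /arrow_linked lAC.
  by apply: exposed3_linked; rewrite ?down_downset //; auto.
- move=> G; rewrite inE => /andP[/andP[GF /eqP->]] _; split=> //.
  apply/subsetP => D /(subsetP GF) dD; apply/imsetP; exists (maxs D).
    exact: maxs_antichain.
  by rewrite down_maxs.
- move=> G A B Gexp antiA antiB AG BG AB.
  have [||] := linked_exposed3 Gexp AG BG.
  + by apply: contraNneq AB => /down_inj->.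
  + by move/arrow_linked; left; auto.
  + by move/arrow_linked; right; auto.
Qed.

(** * Counting *)

Local Notation V := (antichains T).
Local Notation top := (maxs (T:=T) \o lower (T:=T)).
Local Notation arrow1 := (arrow (maxs (T:=T) \o lower (T:=T))).

(** What the counts use about the exceptional antichain. The last clause makes it the same for both
    ends of a cover. *)
Definition admissible (p : {set T} -> {set T}) : Prop :=
  forall B, B \in V -> B != set0 ->
    [/\ p B \in V, below (p B) B & forall A, A \in V -> covers A B -> p A = p B].

Definition indegree (p : {set T} -> {set T}) B := #|[set A in V | arrow p A B]|.

Lemma covers_neq0 A B : covers A B -> B != set0.
Proof.
by move=> /and3P[A0 AB _]; apply: contraNneq A0 => B0; rewrite B0 subset0 in AB.
Qed.

Lemma covers_lower A B : B \in V -> covers A B -> lower A = lower B.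
Proof.
move=> antiB /and3P[/set0Pn[a aA] /subsetP AB _]; apply/setP => i.
rewrite (mem_lower _ antiB (AB a aA)); apply/lowerP/idP => [->//|ia j jA].
by rewrite ltr (antichain_rank antiB (AB j jA) (AB a aA)) -ltr.
Qed.

Lemma below0 A : below A set0 = false.
Proof. by rewrite /below eqxx. Qed.

Lemma arrow_set0 p A : arrow p A set0 = false.
Proof.
rewrite /arrow below0 orbF; apply/negP => /covers_neq0; by rewrite eqxx.
Qed.

Lemma set0_below A : below set0 A = (A != set0).
Proof.
by rewrite /below; case: eqP => //= _; apply/forall_inP => i; rewrite inE.
Qed.

Lemma set0_antichain : set0 \in V.
Proof. by apply/antichainP => i j; rewrite inE. Qed.

Lemma covers_below A B : B \in V -> covers A B -> below A B = false.
Proof.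
move=> antiB /and3P[/set0Pn[a aA] /subsetP AB _]; apply/negP => /belowP[_ ltAB].
by have := ltAB a a aA (AB a aA); rewrite ltxx.
Qed.

Lemma covers_card A B : covers A B -> #|B| = #|A|.+1.
Proof. by move=> /coversP[_ [b bA ->]]; rewrite cardsU1 bA. Qed.

Lemma covers_card_neq1 A B : covers A B -> #|B| != 1.
Proof.
move=> AB; rewrite (covers_card AB) eqSS cards_eq0.
by case/and3P: AB.
Qed.

Lemma below_trans A B C : B != set0 -> below A B -> below B C -> below A C.
Proof.
move=> /set0Pn[b bB] /belowP[_ AB] /belowP[C0 BC]; apply/belowP; split=> // i k iA kC.
exact: lt_trans (AB i b iA bB) (BC b k bB kC).
Qed.

Lemma arrow_below p A B C : arrow p A B -> below B C -> below A C.
Proof.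
case/orP=> [/and3P[_ /subsetP AB _]|/andP[AB _]] BC; last first.
  by apply: (below_trans _ AB BC); case/belowP: AB.
by move/belowP: BC => [C0 BC]; apply/belowP; split=> // i k /AB; apply: BC.
Qed.

Lemma admissible_set0 : admissible (fun=> set0).
Proof.
by move=> B antiB B0; split; rewrite ?set0_antichain ?set0_below.
Qed.

Lemma admissible_top : admissible top.
Proof.
move=> B antiB B0; split=> [||A antiA AB] /=.
- exact: maxs_antichain.
- by rewrite below_lower // /maxs; apply/subsetP => i /maxsP[].
- by rewrite (covers_lower antiB AB).
Qed.

Section Admissible.
Variable p : {set T} -> {set T}.
Hypothesis adm : admissible p.

Lemma card_below_neq B : B \in V -> B != set0 ->
  #|[set A in V | below A B && (A != p B)]| = #|[set A in V | below A B]|.-1.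
Proof.
move=> antiB B0; have [pV pB _] := adm antiB B0.
rewrite (cardsD1 (p B) [set A in V | below A B]) in_set pV pB /=; apply: eq_card => A.
by rewrite in_setD1 !in_set andbA andbC.
Qed.

(** Among the antichains below [B] only [p B] can lack an arrow, and it does so exactly when [B] is
    not a singleton. The resulting count is independent of [p]. *)
Lemma indegreeE B : B \in V -> B != set0 ->
  indegree p B = #|[set A in V | covers A B]| +
    (#|[set A in V | below A B]| - (#|B| != 1)).
Proof.
move=> antiB B0; rewrite /indegree -(cardsID [set A | covers A B]); congr (_ + _).
  apply: eq_card => A; rewrite !in_set -andbA; congr (_ && _).
  by rewrite /arrow; case: (covers A B); rewrite /= ?andbF.
rewrite (_ : _ :\: _ = [set A in V | below A B && ((A != p B) || (#|B| == 1))]).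
  case: eqP => _; first by rewrite subn0; apply: eq_card => A; rewrite !in_set orbT andbT.
  rewrite subn1 -card_below_neq //; apply: eq_card => A; by rewrite !in_set orbF.
apply/setP => A; rewrite !in_set andbC -andbA; congr (_ && _).
rewrite /arrow; have [AB|_] := boolP (covers A B); last by rewrite andbT.
by rewrite andbF covers_below.
Qed.

(** [B] and [C] have the same antichains below them and the same exception, so all of these but
    [p C] point to both. Cardinality excludes a set covered by both, and a set covered by one is not
    below the other. *)
Lemma apex_covers B C : B \in V -> C \in V -> covers B C ->
  #|[set A in V | arrow p A B & arrow p A C]| = #|[set A in V | below A C]|.-1.
Proof.
move=> antiB antiC BC; have C0 := covers_neq0 BC.
have B0 : B != set0 by case/and3P: BC.
rewrite -card_below_neq //; apply: eq_card => A; rewrite !in_set; congr (_ && _).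
have [_ _ pBC] := adm antiC C0; rewrite /= /arrow (pBC B antiB BC).
rewrite (negbTE (covers_card_neq1 BC)) orbF.
have bAE : below A B = below A C by rewrite !below_lower // (covers_lower antiC BC).
rewrite bAE; have [AC|AC] := boolP (covers A C).
  rewrite (covers_below antiC AC) /= orbF andbT; apply/negP => AB.
  have := covers_card AB; have := covers_card AC; have := covers_card BC.
  by move=> -> /succn_inj-> /n_Sn.
have [AB|_] := boolP (covers A B).
  by have := covers_below antiB AB; rewrite bAE => ->.
by case: (below A C); case: (A != p C); rewrite //= andbF.
Qed.

End Admissible.

Lemma indegree_set0 p : indegree p set0 = 0.
Proof. by apply: eq_card0 => A; rewrite in_set arrow_set0 andbF. Qed.

Lemma indegree_admissible p q B : admissible p -> admissible q -> B \in V ->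
  indegree p B = indegree q B.
Proof.
move=> admp admq antiB; have [->|B0] := eqVneq B set0; first by rewrite !indegree_set0.
by rewrite !indegreeE.
Qed.

(** The number of triangles with top vertex [C], summed over the middle vertex. *)
Definition apex (p : {set T} -> {set T}) C :=
  \sum_(B in V | arrow p B C) #|[set A in V | arrow p A B & arrow p A C]|.

Lemma apexE p C : admissible p -> C \in V ->
  apex p C = \sum_(B in V | covers B C) #|[set A in V | below A C]|.-1 +
    \sum_(B in V | below B C && ((B != p C) || (#|C| == 1)))
      #|[set A in V | arrow p A B & arrow p A C]|.
Proof.
move=> adm antiC; rewrite /apex (bigID (fun B => covers B C)) /=; congr (_ + _).
  rewrite (eq_bigl (fun B => (B \in V) && covers B C)) => [|B]; last first.
    by rewrite /arrow; case: (covers B C); rewrite ?andbF ?andbT.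
  by apply: eq_bigr => B /andP[antiB BC]; apply: apex_covers.
apply: eq_bigl => B; rewrite -andbA; congr (_ && _); rewrite /arrow.
have [BC|_] := boolP (covers B C); last by rewrite andbT.
by rewrite andbF covers_below.
Qed.

(** A singleton has no exception, so every arrow into some [B] below [C] completes to a triangle. *)
Lemma apex_single p C : admissible p -> C \in V -> #|C| = 1 ->
  apex p C = \sum_(B in V | covers B C) #|[set A in V | below A C]|.-1 +
    \sum_(B in V | below B C) indegree p B.
Proof.
move=> adm antiC C1; rewrite apexE //; congr (_ + _).
rewrite C1 eqxx (eq_bigl (fun B => (B \in V) && below B C)) => [|B]; last first.
  by rewrite orbT andbT.
apply: eq_bigr => B /andP[antiB BC]; apply: eq_card => A; rewrite !in_set.
congr (_ && _); have [AB|//] := boolP (arrow p A B).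
by rewrite /= [LHS]/arrow (arrow_below AB BC) C1 eqxx !orbT.
Qed.

(** The only loss is the forbidden middle vertex [top C], with its whole in-degree. As a bottom
    vertex [top C] never occurs: an arrow from it to [B] would make [lower C] a proper part of
    [down B], which lies in [lower C]. *)
Lemma apex_top C : C \in V -> 1 < #|C| ->
  apex top C + indegree top (top C) =
    \sum_(B in V | covers B C) #|[set A in V | below A C]|.-1 +
    \sum_(B in V | below B C) indegree top B.
Proof.
move=> antiC C1; have C0 : C != set0 by rewrite -card_gt0; apply: leq_trans C1.
have [topV topC _] := admissible_top antiC C0.
rewrite (apexE admissible_top) // -addnA; congr (_ + _).
rewrite [RHS](bigD1 (top C)) ?topV ?topC //= addnC; congr (_ + _).
rewrite (gtn_eqF C1); apply: eq_big => [B|B /andP[antiB /andP[BC _]]].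
  by rewrite orbF andbA.
apply: eq_card => A; rewrite !in_set -/antichains; case antiA: (A \in V); last first.
  by move: antiA; rewrite in_set => ->.
move: (antiA); rewrite in_set => ->.
have [AB|//] := boolP (arrow1 A B); rewrite /= [LHS]/arrow (arrow_below AB BC).
rewrite (gtn_eqF C1) orbF /= (_ : A != maxs (lower C)) ?orbT //.
apply: contraTneq (arrow_proper antiA antiB AB) => ->.
rewrite down_maxs ?lower_downset // properE negb_and negbK; apply/orP; right.
apply/subsetP => i /downP[b bB ib]; apply/lowerP => c cC.
by apply: le_lt_trans ib _; move/belowP: BC => [_]; apply.
Qed.

(** The exception is now [set0]. As a middle vertex it has no incoming arrow; as a bottom vertex it
    is lost once for each singleton [B], since it points only to singletons. *)
Lemma apex_set0 C : C \in V -> 1 < #|C| ->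
  apex (fun=> set0) C + #|[set B in V | below B C & #|B| == 1]| =
    \sum_(B in V | covers B C) #|[set A in V | below A C]|.-1 +
    \sum_(B in V | below B C) indegree (fun=> set0) B.
Proof.
move=> antiC C1; have C0 : C != set0 by rewrite -card_gt0; apply: leq_trans C1.
rewrite (apexE admissible_set0) // -addnA; congr (_ + _).
rewrite (eq_bigl (fun B => ((B \in V) && below B C) && (B != set0))) => [|B]; last first.
  by rewrite (gtn_eqF C1) orbF andbA.
rewrite big_mkcondr -[X in _ + X = _]sum1_card.
rewrite [X in _ + X = _](eq_bigl (fun B => ((B \in V) && below B C) && (#|B| == 1)))
  => [|B]; last first.
  by rewrite [LHS]in_set andbA.
rewrite [X in _ + X = _]big_mkcondr -big_split; apply: eq_bigr => B /andP[antiB BC] /=.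
have [->|B0] := eqVneq B set0; first by rewrite indegree_set0 cards0.
rewrite /indegree [RHS](cardsD1 set0) in_set set0_antichain addnC; congr (_ + _).
  by rewrite /arrow /covers eqxx set0_below B0 /=; case: eqP.
apply: eq_card => A; rewrite in_setD1 !in_set [RHS]andbCA; congr (_ && _).
have [AB|] := boolP (arrow0 A B); last by rewrite andbF.
rewrite andbT /= [LHS]/arrow (arrow_below AB BC) (gtn_eqF C1) orbF /=.
by rewrite /covers; case: eqP; rewrite //= orbT.
Qed.

Lemma set1_antichain i : [set i] \in V.
Proof. by apply/antichainP => j k /set1P-> /set1P->; rewrite ltxx. Qed.

Lemma card_single_below C : C != set0 ->
  #|[set B in V | below B C & #|B| == 1]| = #|lower C|.
Proof.
move=> C0; rewrite -(card_imset (lower C) set1_inj); apply: eq_card => B.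
apply/idP/imsetP => [|[i iC ->]].
  rewrite inE => /and3P[_ BC /cards1P[i Bi]]; exists i => //.
  by rewrite -sub1set -Bi -below_lower.
by rewrite inE set1_antichain below_lower // sub1set iC cards1.
Qed.

(** The covered sets arise by deleting one element; the factor discards the singleton, from which
    nothing would be left. *)
Lemma card_covers C : C \in V -> #|[set A in V | covers A C]| = (#|C| != 1) * #|C|.
Proof.
move=> antiC; have [C1|C1] := eqVneq #|C| 1.
  apply: eq_card0 => A; rewrite in_set; apply/negP => /andP[_ /covers_card_neq1].
  by rewrite C1.
rewrite mul1n -[RHS](@card_in_imset _ _ (fun i => C :\ i)) => [|i j iC jC].
  apply: eq_card => A; apply/idP/imsetP => [|[i iC ->]].
    rewrite inE => /andP[_ /coversP[_ [b bA CE]]]; exists b; first by rewrite CE setU11.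
    by rewrite CE setU1K.
  rewrite inE; apply/andP; split.
    apply/antichainP => j k; rewrite !inE => /andP[_ jC] /andP[_ kC].
    exact: (antichainP _ antiC).
  apply/coversP; split; last by exists i; rewrite ?setD11 ?setD1K.
  apply: contraNneq C1 => C0; by rewrite -(setD1K iC) C0 setU0 cards1.
move=> /setP/(_ j); rewrite !inE eqxx jC andbT.
by move/negbFE/eqP.
Qed.

Definition wide_below C := #|[set B in V | below B C & 1 < #|B|]|.

(** The successor accounts for the empty antichain, and [#|lower C|] for the singletons. *)
Lemma card_below C : C != set0 ->
  #|[set B in V | below B C]| = (#|lower C| + wide_below C).+1.
Proof.
move=> C0; rewrite -card_single_below // (cardsD1 set0) in_set set0_antichain set0_below C0.
congr (_.+1); rewrite -(cardsID [set B : {set T} | #|B| == 1]).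
congr (_ + _); apply: eq_card => B; rewrite !(in_setI, in_setD1, in_setD) !in_set;
  rewrite -cards_eq0; case: (below B C); case: #|B| => [|[|n]] /=;
  by rewrite ?andbF ?andbT.
Qed.

(** [lower C] is the disjoint union of [top C] and the elements below it. When [top C] is a
    singleton, the missing cover and the missing exception in [indegreeE] balance. *)
Lemma indegree_top C : C \in V -> C != set0 ->
  indegree top (top C) = #|lower C| + wide_below (top C).
Proof.
move=> antiC C0; have [topV _ _] := admissible_top antiC C0.
have dE := down_maxs (lower_downset C).
have [W0|W0] := eqVneq (top C) set0.
  have L0 : lower C = set0.
    apply/setP => i; rewrite -dE -[maxs _]/(top C) W0 in_set0.
    by apply/negP => /downP[j]; rewrite in_set0.
  rewrite W0 indegree_set0 L0 cards0 /wide_below eq_card0 // => A.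
  by rewrite in_set below0 andbF.
rewrite (indegreeE admissible_top) // card_covers // card_below //.
have [w wW] := set0Pn _ W0.
have -> : #|lower C| = #|top C| + #|lower (top C)|.
  rewrite -dE -(cardsID (top C) (down _)); congr (_ + _).
    by congr #|pred_of_set _|; apply/setIidPr/sub_down.
  apply: eq_card => i; rewrite in_setD (mem_down _ topV wW) (mem_lower _ topV wW).
  have [iW|//] := boolP (i \in top C).
  by rewrite (negbTE (antichainP _ topV _ _ iW wW)).
by case: eqP => [->|_]; rewrite ?mul1n ?mul0n ?subn0 ?subn1 /= -?addnA ?addSn.
Qed.

(** For [1 < #|C|] the right-hand sides of [apex_set0] and [apex_top] agree because in-degrees do
    not depend on [p]. The respective losses are [#|lower C|] and
    [#|lower C| + wide_below (top C)]. *)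
Lemma apex_diff C : C \in V ->
  apex (fun=> set0) C = apex top C + (1 < #|C|) * wide_below (top C).
Proof.
move=> antiC; case: (ltngtP #|C| 1) => C1.
- move: C1; rewrite ltnS leqn0 cards_eq0 => /eqP->.
  by rewrite /apex !big_pred0 // => B; rewrite arrow_set0 andbF.
- have C0 : C != set0 by rewrite -card_gt0; apply: leq_trans C1.
  have sumE : \sum_(B in V | below B C) indegree (fun=> set0) B =
      \sum_(B in V | below B C) indegree top B.
    apply: eq_bigr => B /andP[antiB _].
    exact: indegree_admissible admissible_set0 admissible_top antiB.
  have := apex_set0 antiC C1; rewrite sumE -(apex_top antiC C1).
  rewrite (indegree_top antiC C0) card_single_below // mul1n => E.
  by apply: (@addIn #|lower C|); rewrite E addnA addnAC.
- rewrite mul0n addn0 (apex_single admissible_set0) // (apex_single admissible_top) //.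
  congr (_ + _); apply: eq_bigr => B /andP[antiB _].
  exact: indegree_admissible admissible_set0 admissible_top antiB.
Qed.

Lemma card_triangles_diff : #|triangles arrow0 V| =
  #|triangles arrow1 V| + \sum_(C in V | 1 < #|C|) wide_below (top C).
Proof.
rewrite !(card_triangles_sum _ V) [X in _ + X]big_mkcondr -big_split.
apply: eq_bigr => C antiC; rewrite -/(apex _ C) -/(apex _ C) apex_diff //.
by case: (1 < #|C|); rewrite ?mul1n ?mul0n.
Qed.

Lemma contains_XP : contains_X T <->
  exists B C, [/\ B \in V, C \in V, 1 < #|B|, 1 < #|C| & below B (top C)].
Proof.
have pairV i j : (i >< j)%O -> [set i; j] \in V.
  rewrite negb_or => /andP[ij ji]; apply/antichainP => k l.
  by rewrite !inE => /orP[] /eqP-> /orP[] /eqP->; rewrite ?ltxx //;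
    [apply: contraNN ij|apply: contraNN ji]; apply: ltW.
have pair_inc A i j : A \in V -> i \in A -> j \in A -> i != j -> (i >< j)%O.
  move=> /antichainP antiA iA jA ij; rewrite negb_or !le_eqVlt eq_sym.
  by rewrite (eq_sym j) (negbTE ij) !antiA.
split=> [[a [b [c [d [e [U [ab [de [ac [cd [bc ce]]]]]]]]]]]|].
  have [nab nde] : a != b /\ d != e.
    by move: U; rewrite /= !inE !negb_or => /and5P[/and4P[-> _ _ _] _ _ ->].
  have [V1 V2] := (pairV _ _ ab, pairV _ _ de).
  exists [set a; b], [set d; e]; rewrite V1 V2 !cards2 nab nde; split=> //.
  have cL : c \in lower [set d; e].
    by apply/lowerP => i; rewrite !inE => /orP[] /eqP->.
  (* [c] need not be maximal among the common lower bounds of [d] and [e]; a maximal [w] above it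
     is, and the rest of the top antichain shares its rank. *)
  have [w wW cw] : exists2 w, w \in top [set d; e] & (c <= w)%O.
    by apply/downP; rewrite down_maxs ?lower_downset.
  apply/belowP; split=> [|i j iB jW]; first by apply/set0Pn; exists w.
  rewrite ltr (antichain_rank (maxs_antichain _) jW wW) -ltr.
  by apply: lt_le_trans cw; move: iB; rewrite !inE => /orP[] /eqP->.
move=> [B [C [antiB antiC /card_gt1P[a [b [aB bB ab]]] /card_gt1P[d [e [dC eC de]]]]]].
move=> /belowP[/set0Pn[c cW] BW]; have /maxsP[/lowerP cC _] := cW.
have [ac bc cd ce] := And4 (BW a c aB cW) (BW b c bB cW) (cC d dC) (cC e eC).
exists a, b, c, d, e; split; last by split; [|split]; eauto.
rewrite /= !inE !negb_or ab de !(lt_eqF ac, lt_eqF bc, lt_eqF cd, lt_eqF ce).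
by rewrite !(lt_eqF (lt_trans ac cd), lt_eqF (lt_trans ac ce),
             lt_eqF (lt_trans bc cd), lt_eqF (lt_trans bc ce)).
Qed.

Lemma card_triangles_eq :
  #|triangles arrow1 V| = #|triangles arrow0 V| <-> ~ contains_X T.
Proof.
rewrite card_triangles_diff; split=> [E /contains_XP[B [C [antiB antiC B1 C1 BC]]]|noX].
  have /eqP : \sum_(C in V | 1 < #|C|) wide_below (top C) = 0.
    by apply: (@addnI #|triangles arrow1 V|); rewrite addn0.
  rewrite sum_nat_eq0 => /forallP/(_ C)/implyP; rewrite antiC C1 => /(_ isT).
  by rewrite cards_eq0 => /eqP/setP/(_ B); rewrite in_set0 in_set antiB BC B1.
rewrite big1 ?addn0 // => C /andP[antiC C1]; apply/eqP; rewrite cards_eq0.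
apply/eqP/setP => B; rewrite in_set in_set0; apply/negP => /and3P[antiB BC B1].
by apply: noX; apply/contains_XP; exists B, C.
Qed.

End WeakOrder.

Theorem theorem3p6 (R : realType) (disp : Order.disp_t) (T : finPOrderType disp) :
  maximal_ranked T ->
  ((exists n : nat,
      num_tri_2faces (order_polytope R T) n /\
      num_tri_2faces (chain_polytope R T) n)
   <-> ~ contains_X T).
Proof.
move=> mrT; have ltr := maximal_ranked_lt mrT.
have orderP n : num_tri_2faces (order_polytope R T) n <->
    n = #|triangles (arrow (maxs (T:=T) \o lower (T:=T))) (antichains T)|.
  rewrite -(card_exposed3_order ltr R); apply: num_tri_2facesP => x.
    exact: order_polytope_ind.
  exact: order_polytope_conv.
have chainP n : num_tri_2faces (chain_polytope R T) n <->
    n = #|triangles (arrow (fun=> set0)) (antichains T)|.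
  rewrite -(card_exposed3_chain ltr R); apply: num_tri_2facesP => x.
    exact: chain_polytope_ind.
  exact: chain_polytope_conv.
(* Each of the two predicates determines [n], so a common [n] means equal counts. *)
rewrite -(card_triangles_eq ltr); split=> [[n [/orderP <- /chainP <-]]//|E].
by exists #|triangles (arrow (fun=> set0)) (antichains T)|; rewrite orderP chainP.
Qed.
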